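(* Assume that (i) the $\mathbb{P}$-essential infimum of $V$ is $0$ and the $\mathbb{P}$-essential supremum of $V$ is $1$, and (ii) for every $h\in(0,1)$ and $\ell\in\mathbb{N}$, $\mathbb{P}(V(T_y\omega)\le h \text{ for all } y\in\{0,\ldots,\ell\})>0$ and $\mathbb{P}(V(T_y\omega)\ge h \text{ for all } y\in\{0,\ldots,\ell\})>0$. Let $\delta\in(0,1)$, $c=\frac12\log\left(\frac{1+\delta}{1-\delta}\right)$, $\beta\ge\log\cosh(c)$ and $\theta\in\mathbb{R}$. Then for $\mathbb{P}$-a.e. $\omega$ the limit $$u_o(t,x\,|\,\delta,\beta,\theta)=\lim_{\epsilon\to0}\epsilon\, u([\epsilon^{-1}t],[\epsilon^{-1}x],\omega\,|\,\delta,\beta,\theta)$$ exists for every $t>0$ and $x\in\mathbb{R}$. Moreover, $u_o(t,x\,|\,\delta,\beta,\theta)=t\,\overline H_{\delta,\beta}(\theta)+\theta x$, where the effective Hamiltonian $\overline H_{\delta,\beta}(\theta):=u_o(1,0\,|\,\delta,\beta,\theta)$ is deterministic and given by $$\overline H_{\delta,\beta}(\theta)=\begin{cases}\beta-\log\cosh(c)&\text{if }|\theta|<c,\\ \Lambda_\beta(|\theta|-c)-\log\cosh(c)&\text{if }|\theta|\ge c.\end{cases}$$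
   Context: $(\Omega,\mathcal{F},\mathbb{P})$ is a probability space equipped with an ergodic invertible measure-preserving transformation $T:\Omega\to\Omega$; $T_0=I$, $T_k=T\circ T_{k-1}$ and $T_{-k}=(T_k)^{-1}$ for $k\in\mathbb{N}=\{1,2,\ldots\}$. $V:\Omega\to[0,1]$ is a nonconstant measurable function. $[\cdot]$ denotes the floor function. For $n\in\mathbb{N}$ and $\delta\in[0,1]$, $\mathcal{P}_n(\delta)$ is the set of all $\pi=(\pi_0,\ldots,\pi_{n-1})$ where each $\pi_i=\pi_i(n,\omega,y,\pm1)\in[0,1]^2$ is $\mathcal{F}$-measurable in $\omega$ and satisfies $\pi_i(n,\omega,y,-1)+\pi_i(n,\omega,y,1)=1$ and $|\pi_i(n,\omega,y,1)-\pi_i(n,\omega,y,-1)|\le\delta$ for every $i\in\{0,\ldots,n-1\}$, $\omega\in\Omega$, $y\in\mathbb{Z}$. Given $\omega\in\Omega$ and $x\in\mathbb{Z}$, $\pi$ induces the probability measure $P_x^{\pi,\omega}$ (expectation $E_x^{\pi,\omega}$) on paths $(x_0,\ldots,x_n)\in\mathbb{Z}^{n+1}$ with $x_0=x$ and $z_{i+1}=x_{i+1}-x_i\in\{-1,1\}$ by $P_x^{\pi,\omega}(X_0=x_0,\ldots,X_n=x_n)=\prod_{i=0}^{n-1}\pi_i(n,\omega,x_i,z_{i+1})$. Define $$u(n,x,\omega\,|\,\delta,\beta,\theta)=\inf_{\pi\in\mathcal{P}_n(\delta)}\log E_x^{\pi,\omega}\left[e^{\beta\sum_{i=0}^{n-1}V(T_{X_i}\omega)+\theta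 X_n}\right].$$ The tilted free energy is $\Lambda_\beta(\theta)=\lim_{n\to\infty}\frac1n\log E_0\left[e^{\beta\sum_{i=0}^{n-1}V(T_{X_i}\omega)+\theta X_n}\right]$, where $E_0$ is expectation for simple symmetric random walk on $\mathbb{Z}$ started at $0$; under assumptions (i)-(ii) this limit exists for $\mathbb{P}$-a.e. $\omega$ and is deterministic, for every $\beta>0$ and $\theta\in\mathbb{R}$. *)

(* Defs.v *)
From HB Require Import structures.
From mathcomp Require Import all_boot all_order all_algebra.
From mathcomp Require Import all_classical all_reals all_analysis.

Set Implicit Arguments.
Unset Strict Implicit.
Unset Printing Implicit Defensive.

Import Order.TTheory GRing.Theory Num.Theory.
Import numFieldNormedType.Exports.

Local Open Scope classical_set_scope.
Local Open Scope ring_scope.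

Definition measure_preserving (R : realType) (d : measure_display)
    (Omega : measurableType d) (P : probability Omega R) (T : Omega -> Omega) :=
  measurable_fun [set: Omega] T /\
  forall A : set Omega, measurable A -> P (T @^-1` A) = P A.

Definition ergodic (R : realType) (d : measure_display)
    (Omega : measurableType d) (P : probability Omega R) (T : Omega -> Omega) :=
  forall A : set Omega, measurable A -> T @^-1` A = A ->
    P A = 0%E \/ P A = 1%E.

(* [Tinv] is meant to be the two-sided inverse of [T]; [Negz n] is -(n+1). *)
Definition iterT (Omega : Type) (T Tinv : Omega -> Omega) (k : int) :
    Omega -> Omega :=
  match k with
  | Posz n => iter n T
  | Negz n => iter n.+1 Tinv
  end.

Definition cosh (R : realType) (x : R) : R := (expR x + expR (- x)) / 2.

(* Steps of the walk are encoded by booleans: [true] is +1, [false] is -1. *)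
Definition step (b : bool) : int := if b then 1 else -1.

(* A path of length n from x is encoded by its sequence z of n steps. *)
Definition position (n : nat) (x : int) (z : {ffun 'I_n -> bool}) (i : nat) :
    int :=
  x + \sum_(j < n | (j < i)%N) step (z j).

(* [p i y b] is the probability of step b at time i from position y. *)
Definition path_prob (R : realType) (n : nat) (p : 'I_n -> int -> bool -> R)
    (x : int) (z : {ffun 'I_n -> bool}) : R :=
  \prod_(i < n) p i (position x z i) (z i).

Definition path_expectation (R : realType) (n : nat)
    (p : 'I_n -> int -> bool -> R) (x : int) (f : {ffun 'I_n -> bool} -> R) : R :=
  \sum_(z : {ffun 'I_n -> bool}) path_prob p x z * f z.

Definition exp_reward (R : realType) (Omega : Type) (T Tinv : Omega -> Omega)
    (V : Omega -> R) (beta theta : R) (n : nat) (x : int) (w : Omega)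
    (z : {ffun 'I_n -> bool}) : R :=
  expR (beta * (\sum_(i < n) V (iterT T Tinv (position x z i) w))
        + theta * (position x z n)%:~R).

Definition policy (R : realType) (Omega : Type) (n : nat) : Type :=
  'I_n -> Omega -> int -> bool -> R.

Definition admissible (R : realType) (d : measure_display)
    (Omega : measurableType d) (n : nat) (delta : R) : set (policy R Omega n) :=
  [set pi : policy R Omega n | (forall i y b, measurable_fun [set: Omega] (fun w => pi i w y b)) /\
    forall i w y,
      [/\ forall b, 0 <= pi i w y b <= 1,
          pi i w y false + pi i w y true = 1 &
          `|pi i w y true - pi i w y false| <= delta]].

(* The set is nonempty (both steps with probability 1/2) and, V taking values in
   [0, 1] and a path of length n being bounded, it is bounded below. *)
Definition u (R : realType) (d : measure_display) (Omega : measurableType d)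
    (T Tinv : Omega -> Omega) (V : Omega -> R) (delta beta theta : R)
    (n : nat) (x : int) (w : Omega) : R :=
  inf [set ln (path_expectation (fun i => pi i w) x
                 (exp_reward T Tinv V beta theta x w))
      | pi in @admissible R d Omega n delta].

(* For t, eps > 0 the truncation [Num.truncn (eps^-1 * t)] is the floor. *)
Definition scaled_u (R : realType) (d : measure_display)
    (Omega : measurableType d) (T Tinv : Omega -> Omega) (V : Omega -> R)
    (delta beta theta : R) (w : Omega) (t x eps : R) : R :=
  eps * u T Tinv V delta beta theta
          (Num.truncn (eps^-1 * t)) (Num.floor (eps^-1 * x)) w.

Definition u_o (R : realType) (d : measure_display) (Omega : measurableType d)
    (T Tinv : Omega -> Omega) (V : Omega -> R) (delta beta theta : R)
    (w : Omega) (t x : R) : R :=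
  lim (scaled_u T Tinv V delta beta theta w t x eps @[eps --> 0^'+]).

Definition effective_hamiltonian (R : realType) (d : measure_display)
    (Omega : measurableType d) (T Tinv : Omega -> Omega) (V : Omega -> R)
    (delta beta theta : R) (w : Omega) : R :=
  u_o T Tinv V delta beta theta w 1 0.

(* Simple symmetric random walk: both steps have probability 1/2. *)
Definition srw_log_mgf (R : realType) (Omega : Type) (T Tinv : Omega -> Omega)
    (V : Omega -> R) (beta theta : R) (n : nat) (w : Omega) : R :=
  ln (path_expectation (fun (_ : 'I_n) _ _ => 2^-1) 0
        (exp_reward T Tinv V beta theta 0 w)).

(* The deterministic P-a.e. limit; it is unique if it exists, and the default
   value 0 is only taken if there is no such limit. *)
Definition tilted_free_energy (R : realType) (d : measure_display)
    (Omega : measurableType d) (P : probability Omega R)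
    (T Tinv : Omega -> Omega) (V : Omega -> R) (beta theta : R) : R :=
  xget 0 [set l : R | {ae P, forall w,
    n%:R^-1 * srw_log_mgf T Tinv V beta theta n w @[n --> \oo] --> l}].

(* Main.v *)
(* An environment is frozen along an orbit: W k = V (T^k w).  A policy may be
   taken independent of w, so u is an infimum over kernels p, and each bound on
   walk_exp comes from comparing e^(theta x) with a function g that is a sub- or
   supersolution of the one-step recursion, up to factors e^(o(n)).

   Lower bound beta - ln cosh c, for all theta and all policies: near x there is
   a long interval where V is close to 1, and a bump supported on it is a
   subsolution against the worst (outward) drift.  Upper bound for |theta| <= c:
   steer towards a long interval where V is close to 0, with supersolution
   1 + b e^(c|k|); this is where beta >= ln cosh c enters.

   For |theta| >= c and lam > beta, let F be the growing solution of
   F (x + 1) + F (x - 1) = 2 e^(lam - beta W x) F x, built from the Laplace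
   transforms of the hitting times of nearest neighbours.  By the ergodic
   theorem ln F x ~ G(lam) x, where G(lam) >= lam - beta is continuous, and the
   Wronskian shows that the mirror solution has the same exponent.  Since
   e^(cx) F x is monotone, it evolves exactly under the constant extremal drift
   and is a subsolution for every other policy; hence Lambda (|theta| - c) = lam
   if G(lam) = |theta| - c, and Lambda (|theta| - c) = beta if there is no such
   lam. *)
Require Import Defs.
From HB Require Import structures.
From mathcomp Require Import all_boot all_order all_algebra.
From mathcomp Require Import all_classical all_reals all_analysis.
From mathcomp Require Import ess_sup_inf measurable_realfun.
From mathcomp Require Import ring lra zify.

Import Order.TTheory GRing.Theory Num.Theory.
Import numFieldNormedType.Exports.

Local Open Scope classical_set_scope.
Local Open Scope ring_scope.

Set Implicit Arguments.
Unset Strict Implicit.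
Unset Printing Implicit Defensive.

(** * Expectations along controlled walks *)

(** The value of [c] makes [(1 + delta) / 2 = e^c / (2 cosh c)]: a walk with constant drift [delta]
    is the simple walk reweighted by [e^(c x)], at the price [ln (cosh c)] per step. Both the shift
    [|theta| - c] and the term [- ln (cosh c)] come from this. One null set has to serve all [t] and
    [x], so bounds are proved for fixed environments and uniformly over starting points
    [|X| <= C n]. Errors sublinear in [n] are then harmless, and this is all that the ergodic
    theorem yields, both for [ln F] and for the distance to the nearest good interval. The existence
    of [Lambda] is not presupposed: for slopes [|theta| - c >= 0] the two rates that determine [u]
    also determine the growth of the simple walk, whose exponential moment is that of the extremal
    walk up to the exact factor [cosh c ^ n]. When the slope lies below every [G(lam)], the growing
    solutions are too steep to serve as lower bounds and the bulk bound takes over; both bounds then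
    meet at [beta]. *)

Definition kernel_ok (R : realType) (delta : R) (n : nat)
    (p : 'I_n -> int -> bool -> R) :=
  forall i y, [/\ forall b, 0 <= p i y b <= 1, p i y false + p i y true = 1 &
    `|p i y true - p i y false| <= delta].

Definition walk_exp (R : realType) (beta : R) (W f : int -> R) (n : nat)
    (p : 'I_n -> int -> bool -> R) (x : int) : R :=
  path_expectation p x (fun z =>
    expR (beta * \sum_(i < n) W (position x z i)) * f (position x z n)).

Section WalkExp.
Variables (R : realType) (beta : R) (W : int -> R).
Implicit Types (f g : int -> R) (n : nat) (x y : int).

Definition ffun_cons n (b : bool) (z : {ffun 'I_n -> bool}) :
    {ffun 'I_n.+1 -> bool} :=
  [ffun i => if unlift ord0 i is Some j then z j else b].

Lemma position_ffun_cons0 n x b (z : {ffun 'I_n -> bool}) :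
  position x (ffun_cons b z) 0 = x.
Proof. by rewrite /position big_pred0 ?addr0. Qed.

Lemma position_ffun_consS n x b (z : {ffun 'I_n -> bool}) i :
  position x (ffun_cons b z) i.+1 = position (x + step b) z i.
Proof.
rewrite /position big_mkcond big_ord_recl /= ffunE unlift_none -addrA.
congr (_ + (_ + _)); rewrite [RHS]big_mkcond; apply: eq_bigr => j _.
by rewrite /bump /= add1n ltnS ffunE liftK.
Qed.

Lemma path_prob_ffun_cons n (p : 'I_n.+1 -> int -> bool -> R) x b
    (z : {ffun 'I_n -> bool}) :
  path_prob p x (ffun_cons b z) =
  p ord0 x b * path_prob (fun i => p (lift ord0 i)) (x + step b) z.
Proof.
rewrite /path_prob big_ord_recl position_ffun_cons0 ffunE unlift_none.
congr (_ * _); apply: eq_bigr => i _.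
by rewrite lift0 position_ffun_consS ffunE liftK.
Qed.

Lemma walk_exp0 f (p : 'I_0 -> int -> bool -> R) x : walk_exp beta W f p x = f x.
Proof.
rewrite /walk_exp /path_expectation.
have z0 : {ffun 'I_0 -> bool} by apply: finfun; case.
rewrite (bigD1 z0) //= [X in _ + X]big1 ?addr0 => [|z /negP[]].
  by rewrite /path_prob /position !big_ord0 mulr0 expR0 addr0 !mul1r.
by apply/eqP/ffunP; case.
Qed.

Lemma walk_expS f n (p : 'I_n.+1 -> int -> bool -> R) x :
  walk_exp beta W f p x = expR (beta * W x) *
    (p ord0 x true * walk_exp beta W f (fun i => p (lift ord0 i)) (x + 1) +
     p ord0 x false * walk_exp beta W f (fun i => p (lift ord0 i)) (x - 1)).
Proof.
rewrite /walk_exp /path_expectation.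
rewrite (reindex (fun bz : bool * {ffun 'I_n -> bool} =>
  ffun_cons bz.1 bz.2)) /=; last first.
  exists (fun z => (z ord0, [ffun i => z (lift ord0 i)])) => [[b z]|z] _ /=.
    rewrite ffunE unlift_none; congr (_, _).
    by apply/ffunP => i; rewrite !ffunE liftK.
  by apply/ffunP => i; rewrite ffunE; case: unliftP => [j ->|-> //]; rewrite ffunE.
rewrite -(pair_bigA _ (fun b z => path_prob p x (ffun_cons b z) *
  (expR (beta * \sum_(i < n.+1) W (position x (ffun_cons b z) i)) *
   f (position x (ffun_cons b z) n.+1)))) /= big_bool /= mulrDr.
have E b : \sum_(z : {ffun 'I_n -> bool}) path_prob p x (ffun_cons b z) *
  (expR (beta * \sum_(i < n.+1) W (position x (ffun_cons b z) i)) *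
   f (position x (ffun_cons b z) n.+1)) = expR (beta * W x) * (p ord0 x b *
   \sum_(z : {ffun 'I_n -> bool})
     path_prob (fun i => p (lift ord0 i)) (x + step b) z *
   (expR (beta * \sum_(i < n) W (position (x + step b) z i)) *
    f (position (x + step b) z n))).
  rewrite mulrA big_distrr; apply: eq_bigr => z _ /=.
  rewrite path_prob_ffun_cons position_ffun_consS big_ord_recl.
  rewrite position_ffun_cons0 mulrDr expRD.
  have -> : \sum_(i < n) W (position x (ffun_cons b z) (lift ord0 i)) =
      \sum_(i < n) W (position (x + step b) z i).
    by apply: eq_bigr => i _; rewrite lift0 position_ffun_consS.
  by ring.
by rewrite !E.
Qed.

(** Induction on [n], splitting off the first step. The comparison of [f] with [g] is asked only
    where the walk can be after [n] steps, so [A] may carry errors that grow with [n]. The sign of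
    [g] is left free because the upper bound is obtained from [- g]. *)
Lemma walk_exp_ge f g (A rho : R) n (p : 'I_n -> int -> bool -> R) x :
  0 <= rho -> (forall i y b, 0 <= p i y b) ->
  (forall i y, rho * g y <=
     expR (beta * W y) * (p i y true * g (y + 1) + p i y false * g (y - 1))) ->
  (forall y, `|y - x| <= n%:Z -> A * g y <= f y) -> 0 <= A ->
  A * rho ^+ n * g x <= walk_exp beta W f p x.
Proof.
move=> rho0 p0 gsub; move: p p0 gsub x; elim: n => [|n IH] p p0 gsub x fg A0.
  by rewrite walk_exp0 expr0 mulr1 fg // subrr normr0.
rewrite walk_expS exprSr mulrA -[A * _ * _ * _]mulrA.
have Ar0 : 0 <= A * rho ^+ n by rewrite mulr_ge0// exprn_ge0.
apply: (le_trans (ler_wpM2l Ar0 (gsub ord0 x))).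
rewrite mulrCA ler_pM2l ?expR_gt0// mulrDr 2![A * rho ^+ n * (_ * _)]mulrCA.
by apply: lerD; apply: ler_wpM2l => //; apply: IH => // y Hy; apply: fg;
  move: Hy; rewrite !ler_norml -addn1 PoszD => /andP[H1 H2];
  apply/andP; split; lia.
Qed.

Lemma walk_exp_le f g (A rho : R) n (p : 'I_n -> int -> bool -> R) x :
  0 <= rho -> (forall i y b, 0 <= p i y b) ->
  (forall i y,
     expR (beta * W y) * (p i y true * g (y + 1) + p i y false * g (y - 1))
     <= rho * g y) ->
  (forall y, `|y - x| <= n%:Z -> f y <= A * g y) -> 0 <= A ->
  walk_exp beta W f p x <= A * rho ^+ n * g x.
Proof.
move=> rho0 p0 gsup fg A0.
have H : A * rho ^+ n * - g x <= walk_exp beta W (fun y => - f y) p x.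
  apply: (@walk_exp_ge _ (fun y => - g y)) => // [i y|y Hy].
    by rewrite !mulrN -opprD mulrN lerN2; exact: gsup.
  by rewrite mulrN lerN2 fg.
rewrite -lerN2 -mulrN (le_trans H)// /walk_exp /path_expectation -sumrN.
by apply: ler_sum => z _; rewrite !mulrN.
Qed.

End WalkExp.

(** * Birkhoff's ergodic theorem *)

Definition bsum (Omega : Type) (R : realType) (T : Omega -> Omega)
    (g : Omega -> R) (n : nat) (w : Omega) : R := \sum_(i < n) g (iter i T w).

Lemma bsumS (Omega : Type) (R : realType) (T : Omega -> Omega)
    (g : Omega -> R) n w : bsum T g n.+1 w = g w + bsum T g n (T w).
Proof.
by rewrite /bsum big_ord_recl; congr (_ + _); apply: eq_bigr => i _; rewrite -iterSr.
Qed.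

Section Birkhoff.
Context (R : realType) (d : measure_display) (Omega : measurableType d).
Variables (P : probability Omega R) (T : Omega -> Omega).
Hypothesis T_mp : measure_preserving P T.
Implicit Types (f g : Omega -> R) (B : R).

Lemma bounded_integrable f B : measurable_fun [set: Omega] f ->
  (forall w, `|f w| <= B) -> P.-integrable [set: Omega] (EFin \o f).
Proof.
move=> mf fB; apply: measurable_bounded_integrable => //.
  by rewrite -ge0_fin_numE// fin_num_measure.
by exists B; split; [exact: num_real|move=> x Bx w _; exact: le_trans (fB w) (ltW Bx)].
Qed.

Lemma Rintegral_comp_mp f B : measurable_fun [set: Omega] f ->
  (forall w, `|f w| <= B) -> (\int[P]_w f (T w)) = \int[P]_w f w.
Proof.
move=> mf fB; have [mT PT] := T_mp.
rewrite /Rintegral; congr fine.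
rewrite -[RHS](@eq_measure_integral _ _ _ _ P (pushforward P T)) => [|A mA _].
  rewrite integral_pushforward//; first exact/measurable_EFinP.
  rewrite preimage_setT; apply: (@bounded_integrable (f \o T) B) => [|w].
    exact: measurableT_comp.
  exact: fB.
exact: PT.
Qed.

(** The maximum of the ergodic sums of lengths 0 to [n], in the recursive form that makes the
    maximal inequality a one-line identity. *)
Fixpoint bmax g n w := if n is n'.+1 then Num.max 0 (g w + bmax g n' (T w)) else 0.

Lemma bmax_ge0 g n w : 0 <= bmax g n w.
Proof. by case: n => //= n; rewrite le_max lexx. Qed.

Lemma bmax_le g n w : bmax g n w <= bmax g n.+1 w.
Proof.
elim: n w => [|n IH] w; first exact: bmax_ge0.
by rewrite [leLHS]/= [leRHS]/= ge_max !le_max lexx lerD2l IH orbT.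
Qed.

Lemma bmax_homo g w : {homo bmax g ^~ w : m n / (m <= n)%N >-> m <= n}.
Proof. by apply: homo_leq => // [y x z|n]; [exact: le_trans|exact: bmax_le]. Qed.

Lemma bsum_le_bmax g n w : bsum T g n w <= bmax g n w.
Proof.
elim: n w => [|n IH] w; first by rewrite /bsum big_ord0.
by rewrite bsumS /= le_max lerD2l IH orbT.
Qed.

Lemma bmax_bound g B n w : (forall w, `|g w| <= B) -> `|bmax g n w| <= B *+ n.
Proof.
move=> gB; have B0 : 0 <= B by rewrite (le_trans _ (gB w)).
rewrite ger0_norm ?bmax_ge0//.
elim: n w => [|n IH] w; first by rewrite mulr0n.
rewrite /= ge_max mulrn_wge0//= mulrS lerD//.
exact: le_trans (ler_norm _) (gB _).
Qed.

Lemma measurable_bmax g n : measurable_fun [set: Omega] g ->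
  measurable_fun [set: Omega] (bmax g n).
Proof.
move=> mg; have [mT _] := T_mp; elim: n => [|n IH]; first exact: measurable_cst.
apply: measurable_maxr; first exact: measurable_cst.
by apply: measurable_funD => //; exact: measurableT_comp.
Qed.

Lemma measurable_bsum g n : measurable_fun [set: Omega] g ->
  measurable_fun [set: Omega] (bsum T g n).
Proof.
move=> mg; have [mT _] := T_mp; elim: n => [|n IH].
  rewrite (_ : bsum T g 0 = cst 0); first exact: measurable_cst.
  by apply/funext => w; rewrite /bsum big_ord0.
rewrite (_ : bsum T g n.+1 = g \+ (bsum T g n \o T)); last first.
  by apply/funext => w; exact: bsumS.
by apply: measurable_funD => //; exact: measurableT_comp.
Qed.

(** By the recursion the integrand equals [bmax g n.+1 - bmax g n o T]. By invariance its integral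
    is that of [bmax g n.+1 - bmax g n], which is nonnegative. *)
Lemma Rintegral_maxN_bmax_ge0 g B n : measurable_fun [set: Omega] g ->
  (forall w, `|g w| <= B) ->
  0 <= \int[P]_w Num.max (g w) (- bmax g n (T w)).
Proof.
move=> mg gB; have [mT _] := T_mp.
have mM := measurable_bmax.
have iM k : P.-integrable [set: Omega] (EFin \o bmax g k).
  by apply: (@bounded_integrable _ (B *+ k)) => [|w]; [exact: mM|exact: bmax_bound].
have iMT : P.-integrable [set: Omega] (EFin \o (bmax g n \o T)).
  apply: (@bounded_integrable _ (B *+ n)) => [|w]; last exact: bmax_bound.
  by apply: measurableT_comp => //; exact: mM.
rewrite (_ : (fun w => _) = (fun w => bmax g n.+1 w - bmax g n (T w))); last first.
  apply/funext => w /=; rewrite /Num.max; case: ltP => ?; case: ltP => ?; lra.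
rewrite RintegralB// subr_ge0 (@Rintegral_comp_mp _ (B *+ n))//.
- by apply: le_Rintegral => // w _; exact: bmax_le.
- exact: mM.
- by move=> w; exact: bmax_bound.
Qed.

(** Where the sums are unbounded above, the integrand of the previous lemma is eventually equal to
    [g], and it is bounded by [B]; dominated convergence passes its sign on to [g]. *)
Lemma maximal_ergodic g B : measurable_fun [set: Omega] g ->
  (forall w, `|g w| <= B) ->
  {ae P, forall w, forall K : nat, exists n, K%:R < bsum T g n w} ->
  0 <= \int[P]_w g w.
Proof.
move=> mg gB gA; have [mT _] := T_mp.
pose D n w := Num.max (g w) (- bmax g n (T w)).
have mD n : measurable_fun [set: Omega] (D n).
  apply: measurable_maxr => //; apply: measurableT_comp => //.
  by apply: measurableT_comp => //; exact: measurable_bmax.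
have DB n w : `|D n w| <= B.
  have := gB w; have := bmax_ge0 g n (T w); rewrite /D /Num.max.
  case: ltP => // h1 h2 h3; have B0 := le_trans (normr_ge0 _) h3.
  rewrite ler_norml; move: h3; rewrite ler_norml => /andP[h3 h4]; lra.
have Dg : {ae P, forall w, [set: Omega] w ->
    (D n w)%:E @[n --> \oo] --> (g w)%:E}.
  (* A sum above [2 B] forces [bsum T g n.+1 w = g w + bsum T g n (T w)] to be nonnegative. Hence
     [g w] wins the maximum in [D n], and keeps winning since [bmax] increases with [n]. *)
  apply: filterS gA => w /(_ (Num.truncn (2 * B)).+1)[n nB] _.
  apply: cvg_near_cst; exists n => // m /= nm; rewrite /D; congr EFin.
  apply/max_idPl; rewrite lerNl.
  have : bsum T g n.+1 w <= bmax g n.+1 w by exact: bsum_le_bmax.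
  have := @bmax_homo g (T w) _ _ nm; have := bsum_le_bmax g n (T w).
  have : bsum T g n.+1 w = bsum T g n w + g (iter n T w).
    by rewrite /bsum big_ord_recr.
  rewrite bsumS; have /andP[_ h] := truncn_itv (mulr_ge0 (ler0n R 2)
     (le_trans (normr_ge0 _) (gB w))).
  have := gB w; have := gB (iter n T w); rewrite !ler_norml => /andP[? ?] /andP[? ?].
  lra.
have [] := @dominated_convergence _ _ _ P _ measurableT
  (fun n => EFin \o D n) (EFin \o g) (cst B%:E).
- by move=> n; exact/measurable_EFinP.
- exact/measurable_EFinP.
- exact: Dg.
- by apply: (@bounded_integrable (cst B) `|B|) => //.
- by apply: aeW => w n _ /=; rewrite lee_fin DB.
move=> ig _ cI; rewrite -lee_fin /Rintegral fineK; last first.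
  by apply: integrable_fin_num => //.
apply: (cvge_ge _ cI); apply: nearW => n.
have := Rintegral_maxN_bmax_ge0 n mg gB.
rewrite -lee_fin /Rintegral fineK //.
by apply: integrable_fin_num => //; exact: (@bounded_integrable (D n) B).
Qed.

Hypothesis T_erg : ergodic P T.

(** Unboundedness of the sums is an invariant event. If it had probability 1, the maximal inequality
    would contradict the negative mean. *)
Lemma bsum_bounded_above g B : measurable_fun [set: Omega] g ->
  (forall w, `|g w| <= B) -> \int[P]_w g w < 0 ->
  {ae P, forall w, exists K : nat, forall n, bsum T g n w <= K%:R}.
Proof.
move=> mg gB gneg.
pose A := [set w | forall K : nat, exists n, K%:R < bsum T g n w].
have mA : measurable A.
  rewrite (_ : A = \bigcap_K \bigcup_n (bsum T g n @^-1` `]K%:R, +oo[)); last first.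
    apply/seteqP; split => w /= wA K.
      by move=> _; have [n Kn] := wA K; exists n => //=; rewrite in_itv/= Kn.
    by have [n _] := wA K I; rewrite /= in_itv /= andbT; exists n.
  apply: bigcapT_measurable => K; apply: bigcupT_measurable => n.
  by rewrite -[X in measurable X]setTI; apply: measurable_bsum.
have TA : T @^-1` A = A.
  (* Ergodicity is stated for strictly invariant sets. The sums from [w] and from [T w] differ by an
     index shift and one bounded term, which gives invariance without a null set. *)
  have shift (c : R) (F G : nat -> R) : (forall n, G n.+1 = F n + c) ->
      G 0%N = 0 -> F 0%N = 0 ->
      (forall K : nat, exists n, K%:R < F n) <-> (forall K : nat, exists n, K%:R < G n).
    move=> FG G0 F0; split=> H K.
      have [n Hn] := H (K + (Num.truncn `|c|).+1)%N; exists n.+1; rewrite FG.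
      have := truncnS_gt `|c|; move: Hn; rewrite natrD.
      by have := ler_norm (- c); rewrite normrN; lra.
    have [n] := H (K + (Num.truncn `|c|).+1)%N; case: n => [|n].
      by rewrite G0 ltNge ler0n.
    rewrite FG natrD => Hn; exists n; have := truncnS_gt `|c|.
    by have := ler_norm c; lra.
  apply/seteqP; split=> w; rewrite /A /=;
    apply (shift (g w) (fun n => bsum T g n (T w)) (fun n => bsum T g n w)) => [n||];
    by rewrite ?bsumS 1?addrC // /bsum big_ord0.
have [PA|PA] := T_erg mA TA.
  have : {ae P, forall w, ~ A w}.
    by exists A; split => // w /= /contrapT.
  apply: filterS => w /existsNP[K /forallNP HK].
  by exists K => n; rewrite leNgt; apply/negP/HK.
suff : 0 <= \int[P]_w g w by rewrite leNgt gneg.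
apply: (maximal_ergodic mg gB); exists (~` A); split => //.
  exact: measurableC.
by rewrite probability_setC// PA subee.
Qed.

End Birkhoff.

(** For [s = 1] and [s = -1], the function [s f - (s m + 1/(k+1))] has mean [- 1/(k+1)], so its sums
    are bounded above almost surely. Countably many [k] serve every [e]. The form [e n + K] also
    covers small [n]. *)
Lemma birkhoff (R : realType) (d : measure_display) (Omega : measurableType d)
  (P : probability Omega R) (T : Omega -> Omega) (f : Omega -> R) (B : R) :
  measure_preserving P T -> ergodic P T -> measurable_fun [set: Omega] f ->
  (forall w, `|f w| <= B) ->
  {ae P, forall w, forall e : R, 0 < e -> exists K : R,
     forall n, `|bsum T f n w - n%:R * \int[P]_w f w| <= e * n%:R + K}.
Proof.
move=> T_mp T_erg mf fB; set m := \int[P]_w f w.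
have B0 : 0 <= B by rewrite (le_trans _ (fB point)).
have upper (s : R) k : `|s| <= 1 -> {ae P, forall w, exists K : nat, forall n,
    bsum T (fun w => s * f w - (s * m + k.+1%:R^-1)) n w <= K%:R}.
  move=> s1; have mg : measurable_fun [set: Omega] (fun w => s * f w).
    by apply: measurable_funM => //; exact: measurable_cst.
  have gB w : `|s * f w| <= B.
    by rewrite normrM (le_trans _ (fB w))// ler_piMl.
  apply: (@bsum_bounded_above _ _ _ _ _ T_mp T_erg _ (B + `|s * m + k.+1%:R^-1|)).
  - by apply: measurable_funB => //; exact: measurable_cst.
  - by move=> w; rewrite (le_trans (ler_normB _ _))// lerD2r.
  - rewrite RintegralB//; [|exact: bounded_integrable gB|]; last first.
      by apply: (@bounded_integrable _ _ _ _ _ `|s * m + k.+1%:R^-1|).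
    rewrite RintegralZl//; last exact: bounded_integrable fB.
    rewrite Rintegral_cst//.
    have -> : fine (P [set: Omega]) = 1 by have := @probability_setT _ _ _ P => ->.
    rewrite mulr1 /m opprD addrA subrr add0r.
    by rewrite oppr_lt0 invr_gt0 ltr0n.
have sumE s k n w : bsum T (fun w => s * f w - (s * m + k.+1%:R^-1)) n w =
    s * (bsum T f n w - n%:R * m) - n%:R * k.+1%:R^-1.
  rewrite /bsum sumrB sumr_const card_ord -mulr_sumr -mulr_natl; ring.
have up k := @upper 1 k; have dn k := @upper (-1) k.
have := ae_foralln (fun k => up k _); have := ae_foralln (fun k => dn k _).
rewrite normrN normr1; move=> /(_ (lexx _)) A1 /(_ (lexx _)) A2.
apply: filterS2 A1 A2 => w A1 A2 e e0.
have [k ke] : exists k, k.+1%:R^-1 <= e.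
  exists (Num.truncn e^-1); rewrite -[leRHS]invrK lef_pV2 ?posrE ?invr_gt0//.
  by rewrite ltW// truncnS_gt.
have [K1 H1] := A1 k; have [K2 H2] := A2 k; exists (K1%:R + K2%:R) => n.
have := H1 n; have := H2 n; rewrite !sumE.
have : n%:R * k.+1%:R^-1 <= e * n%:R by rewrite mulrC ler_wpM2r.
have := ler0n R K1; have := ler0n R K2; rewrite ler_norml.
set x := bsum T f n w - _; set y := _ / _; set z := _ * n%:R => *.
by apply/andP; split; lra.
Qed.

(** * Two-sided ergodic sums *)

Section TwoSided.
Variables (Omega : Type) (T Tinv : Omega -> Omega).
Hypotheses (TK : cancel T Tinv) (TinvK : cancel Tinv T).

Lemma iterT_succ (k : int) w : iterT T Tinv (k + 1) w = T (iterT T Tinv k w).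
Proof.
case: k => [n|[|n]]; first by rewrite -PoszD addn1.
  by rewrite /= TinvK.
by rewrite (_ : Negz n.+1 + 1 = Negz n) /= ?TinvK// !NegzE; lia.
Qed.

Lemma iterT_pred (k : int) w : iterT T Tinv (k - 1) w = Tinv (iterT T Tinv k w).
Proof. by rewrite -[k in RHS](subrK 1) iterT_succ TK. Qed.

Lemma iterT_opp (k : int) w : iterT Tinv T (- k) w = iterT T Tinv k w.
Proof. by case: k => [[|n]|n]. Qed.

End TwoSided.

Definition asymp_linear (R : realType) (S : int -> R) (m : R) :=
  forall e : R, 0 < e -> exists K : R,
    forall k : int, `|S k - k%:~R * m| <= e * `|k%:~R| + K.

(** The cocycle of [f] over all integers, signed so that [isum_succ] holds everywhere. At [-(n+1)]
    it is minus the sum over the orbit points [-1, ..., -(n+1)], hence the start at [Tinv w]. *)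
Definition isum (Omega : Type) (R : realType) (T Tinv : Omega -> Omega)
    (f : Omega -> R) (k : int) (w : Omega) : R :=
  match k with
  | Posz n => bsum T f n w
  | Negz n => - bsum Tinv f n.+1 (Tinv w)
  end.

Lemma isum_succ (Omega : Type) (R : realType) (T Tinv : Omega -> Omega)
    (f : Omega -> R) (k : int) (w : Omega) :
  isum T Tinv f (k + 1) w = isum T Tinv f k w + f (iterT T Tinv k w).
Proof.
case: k => [n|[|n]]; first by rewrite -PoszD addn1 /= /bsum big_ord_recr.
  by rewrite /= /bsum big_ord0 big_ord1 addNr.
rewrite (_ : Negz n.+1 + 1 = Negz n) /=; last by rewrite !NegzE; lia.
rewrite /bsum [in RHS]big_ord_recr /= opprD -addrA -iterSr.
by rewrite -[iter n.+1 _ _]/(Tinv (iter n Tinv _)) addNr addr0.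
Qed.

Lemma birkhoff_int (R : realType) (d : measure_display)
  (Omega : measurableType d) (P : probability Omega R) (T Tinv : Omega -> Omega)
  (TK : cancel T Tinv) (TinvK : cancel Tinv T)
  (T_mp : measure_preserving P T) (Tinv_mp : measure_preserving P Tinv)
  (T_erg : ergodic P T) (Tinv_erg : ergodic P Tinv)
  (f : Omega -> R) (B : R) : measurable_fun [set: Omega] f ->
  (forall w, `|f w| <= B) ->
  {ae P, forall w, asymp_linear (isum T Tinv f ^~ w) (\int[P]_w f w)}.
Proof.
move=> mf fB; set m := \int[P]_w f w.
apply: filterS2 (birkhoff T_mp T_erg mf fB) (birkhoff Tinv_mp Tinv_erg mf fB).
move=> w H1 H2 e e0; have [K1 {}H1] := H1 e e0; have [K2 {}H2] := H2 e e0.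
(* The backward ergodic sum starts at [w], but [isum] starts at [Tinv w]; [e], [|f w|] and [|m|] pay
   for this shift by one. *)
exists (`|K1| + `|K2| + e + `|f w| + `|m|) => -[n|n] /=.
  rewrite -[n%:~R]/(n%:R) normr_nat (le_trans (H1 n))// lerD2l.
  have := ler_norm K1; have := normr_ge0 K2; have := normr_ge0 (f w).
  by have := normr_ge0 m; lra.
rewrite NegzE mulrNz -[n.+1%:~R]/(n.+1%:R) normrN normr_nat mulNr opprK addrC.
have := H2 n.+2; rewrite bsumS -[n.+2]addn1 natrD; set S := bsum _ _ _ _.
rewrite mulrDl mul1r mulrDr mulr1 -/m.
set x := n.+1%:R * m; set y := e * n.+1%:R => /ler_normlP[h1 h2].
have := ler_norm K2; have := normr_ge0 K1.
have := ler_norm (f w); have := ler_norm (- f w); rewrite normrN.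
have := ler_norm m; have := ler_norm (- m); rewrite normrN => *.
by apply/ler_normlP; split; lra.
Qed.

(** On a gap of [E] to the right of [X] the function [S] is constant, while it should gain [m] per
    site. A gap of length [L] is thus possible only if the errors at [X] and [X + L] add up to
    [m L]. *)
Lemma asymp_linear_gap (R : realType) (S : int -> R) (m : R) (E : int -> Prop) :
  0 < m -> asymp_linear S m -> (forall k, ~ E k -> S (k + 1) = S k) ->
  forall e : R, 0 < e -> exists K : R, forall X : int,
    exists y : int, E y /\ `|(y - X)%:~R| <= e * `|X%:~R| + K :> R.
Proof.
(* The bound [e' <= m / 2] absorbs the part of the error proportional to the gap length, and
   [e' <= m e / 4] turns the part proportional to [|X|] into [e |X|]. *)
move=> m0 Sm SE e e0; pose e' := m * Num.min (2^-1) (e / 4).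
have e'0 : 0 < e' by rewrite mulr_gt0// lt_min invr_gt0 divr_gt0 ?ltr0n.
have e'1 : 2 * e' <= m by rewrite mulrCA ler_piMr ?(ltW m0)// -ler_pdivlMl// mulr1 ge_min lexx.
have e'2 : 4 * e' <= m * e by rewrite mulrCA ler_pM2l// -ler_pdivlMl// mulrC ge_min lexx orbT.
have [K HK] := Sm e' e'0.
have K0 : 0 <= K by have := HK 0; rewrite normr0 mulr0 add0r; exact: le_trans.
exists (4 * K / m) => X; set M := e * `|X%:~R| + _.
have M0 : 0 <= M.
  by rewrite addr_ge0// ?mulr_ge0// ?(ltW e0)// invr_ge0 ltW.
have [//|noy] := pselect (exists y : int, E y /\ `|(y - X)%:~R| <= M).
have [L LM ML] : exists2 L : nat, forall n, (n < L)%N -> n%:R <= M & M < L%:R.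
  exists (Num.truncn M).+1; last exact: truncnS_gt.
  by move=> n; rewrite ltnS truncn_ge_nat.
have Sconst n : (n <= L)%N -> S (X + n%:Z) = S X.
  elim: n => [|n IH] nL; first by rewrite addr0.
  rewrite (_ : X + n.+1%:Z = X + n%:Z + 1); last by rewrite -addn1 PoszD addrA.
  rewrite SE; first exact/IH/ltnW.
  move=> En; apply: noy; exists (X + n%:Z); split => //.
  by rewrite addrC addKr -[n%:~R]/(n%:R) normr_nat LM.
have := HK X; have := HK (X + L%:Z); rewrite Sconst//.
rewrite intrD -[L%:Z%:~R]/(L%:R).
move: ML; move: (ler0n R L); move: (L%:R : R) => N N0; rewrite /M => MN.
have := ler_normD X%:~R N; rewrite (ger0_norm N0); set x := X%:~R; set s := S X.
set z := `|x + N| => hz; have x0 := normr_ge0 x.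
rewrite !ler_norml => /andP[h1 _] /andP[_ h2]; exfalso.
have {}MN : e * `|x| * m + 4 * K < N * m.
  by move: MN; rewrite -(ltr_pM2r m0) mulrDl divfK// gt_eqF.
have : e' * z <= e' * (`|x| + N) by rewrite ler_pM2l.
have : 4 * e' * `|x| <= m * e * `|x| by exact: ler_wpM2r.
have : 2 * e' * N <= m * N by exact: ler_wpM2r.
rewrite mulrDl in h1; rewrite mulrDr; lra.
Qed.

(** * Hitting-time transforms *)

Section HittingTransform.
Context (R : realType) (d : measure_display) (Omega : measurableType d).
Variables (Tinv : Omega -> Omega) (V : Omega -> R) (beta : R).
Hypotheses (mTinv : measurable_fun [set: Omega] Tinv).
Hypotheses (mV : measurable_fun [set: Omega] V) (V01 : forall w, 0 <= V w <= 1).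
Hypothesis beta0 : 0 <= beta.

(** The equation [F x = e^(beta V - lam) (F (x + 1) + F (x - 1)) / 2] of the killed simple walk,
    solved for the sum of the neighbours, has this coefficient. *)
Definition green_coef (lam : R) (w : Omega) : R := 2 * expR (lam - beta * V w).

(* With [tau] the hitting time of the right neighbour by the simple walk, [hit]
   is [E e^(sum_(i < tau) (beta V - lam))]; by the strong Markov property it
   solves [hit w = 1 / (green_coef w - hit (Tinv w))], and it is built as the
   limit of that continued fraction. *)
Fixpoint hit_iter (lam : R) (n : nat) (w : Omega) : R :=
  if n is n'.+1 then (green_coef lam w - hit_iter lam n' (Tinv w))^-1 else 0.

Definition hit (lam : R) (w : Omega) : R := limn (hit_iter lam ^~ w).

Lemma hit_iterS lam n w :
  hit_iter lam n.+1 w = (green_coef lam w - hit_iter lam n (Tinv w))^-1.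
Proof. by []. Qed.

Lemma green_coef_ge lam w : 2 * expR (lam - beta) <= green_coef lam w.
Proof.
rewrite ler_pM2l ?ltr0n// ler_expR lerD2l lerN2.
by have /andP[_ h] := V01 w; rewrite ler_piMr.
Qed.

Lemma green_coef_le lam w : green_coef lam w <= 2 * expR lam.
Proof.
rewrite ler_pM2l ?ltr0n// ler_expR gerBl mulr_ge0//.
by have /andP[] := V01 w.
Qed.

(** As [lam > beta], the coefficient is at least [2 e^(lam - beta) > 2]. Subtracting a number at
    most 1 leaves at least [e^(lam - beta)], so the interval is mapped into itself. *)
Lemma hit_iter_itv lam n w : beta < lam ->
  0 <= hit_iter lam n w <= expR (- (lam - beta)).
Proof.
move=> bl; have k1 : 1 < expR (lam - beta) by rewrite expR_gt1 subr_gt0.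
elim: n w => [|n IH] w; first by rewrite /= lexx expR_ge0.
have /andP[h1 h2] := IH (Tinv w); have h3 := green_coef_ge lam w.
have h4 : expR (- (lam - beta)) <= 1 by rewrite expRN invf_le1 ?expR_gt0// ltW.
have h5 : expR (lam - beta) <= green_coef lam w - hit_iter lam n (Tinv w) by lra.
have h6 := expR_gt0 (lam - beta).
rewrite /= invr_ge0 (le_trans _ h5) ?expR_ge0//= expRN lef_pV2 ?posrE//.
exact: lt_le_trans h5.
Qed.

Lemma green_sub_gt0 lam n w : beta < lam ->
  0 < green_coef lam w - hit_iter lam n (Tinv w).
Proof.
move=> bl; have k1 : 1 < expR (lam - beta) by rewrite expR_gt1 subr_gt0.
have /andP[h1 h2] := hit_iter_itv n (Tinv w) bl; have h3 := green_coef_ge lam w.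
have h4 : expR (- (lam - beta)) <= 1 by rewrite expRN invf_le1 ?expR_gt0// ltW.
lra.
Qed.

Lemma hit_iter_nondecreasing lam w : beta < lam ->
  nondecreasing_seq (hit_iter lam ^~ w).
Proof.
move=> bl; apply/nondecreasing_seqP => n; elim: n w => [|n IH] w.
  by have /andP[] := hit_iter_itv 1 w bl.
by rewrite [leLHS]hit_iterS [leRHS]hit_iterS lef_pV2 ?posrE ?green_sub_gt0// lerD2l lerN2.
Qed.

Lemma hit_cvg lam w : beta < lam -> hit_iter lam ^~ w @ \oo --> hit lam w.
Proof.
move=> bl; apply: nondecreasing_is_cvgn; first exact: hit_iter_nondecreasing.
by exists (expR (- (lam - beta))) => _ [n _ <-]; have /andP[] := hit_iter_itv n w bl.
Qed.

Lemma measurable_hit lam : beta < lam -> measurable_fun [set: Omega] (hit lam).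
Proof.
move=> bl; apply: (measurable_fun_cvg (h := hit_iter lam)) => [n|w _]; last first.
  exact: hit_cvg.
elim: n => [|n IH]; first exact: measurable_cst.
rewrite (_ : hit_iter lam n.+1 = fun w =>
    expR (- ln (green_coef lam w - hit_iter lam n (Tinv w)))); last first.
  by apply/funext => w; rewrite expRN lnK// posrE green_sub_gt0.
apply: measurableT_comp => //; apply: measurableT_comp => //.
apply: measurableT_comp => //.
apply: measurable_funB; last exact: measurableT_comp.
apply: measurable_funM; first exact: measurable_cst.
apply: measurableT_comp => //; apply: measurable_funB; first exact: measurable_cst.
by apply: measurable_funM => //; exact: measurable_cst.
Qed.

Lemma hitE lam w : beta < lam ->
  hit lam w * (green_coef lam w - hit lam (Tinv w)) = 1.
Proof.
move=> bl.
have c1 : (fun n => hit_iter lam n.+1 w * (green_coef lam w - hit_iter lam n (Tinv w)))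
    @ \oo --> hit lam w * (green_coef lam w - hit lam (Tinv w)).
  apply: cvgM; first by rewrite (cvg_shiftS (hit_iter lam ^~ w)); exact: hit_cvg.
  by apply: cvgB; [exact: cvg_cst|exact: hit_cvg].
apply: (cvg_unique _ c1) => //.
rewrite (_ : (fun n => _) = cst 1); first exact: cvg_cst.
by apply/funext => n /=; rewrite mulVf// gt_eqF// green_sub_gt0.
Qed.

Lemma hit_le lam w : beta < lam -> 0 <= hit lam w <= expR (- (lam - beta)).
Proof.
move=> bl; have c := @hit_cvg lam w bl; apply/andP; split.
  by apply: (ler_cvg_to (cvg_cst 0) c); apply: nearW => n; have /andP[] := hit_iter_itv n w bl.
by apply: (ler_cvg_to c (cvg_cst _)); apply: nearW => n; have /andP[] := hit_iter_itv n w bl.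
Qed.

Lemma hit_gt0 lam w : beta < lam -> 0 < hit lam w.
Proof.
move=> bl; have /andP[h _] := hit_le w bl; rewrite lt_neqAle h andbT eq_sym.
by apply/eqP => h0; have := hitE w bl; rewrite h0 mul0r => /esym/eqP; rewrite oner_eq0.
Qed.

Lemma hit_ge lam w : beta < lam -> (2 * expR lam)^-1 <= hit lam w.
Proof.
move=> bl; have h1 := hitE w bl; have h2 := hit_gt0 w bl.
have /andP[h3 _] := hit_le (Tinv w) bl; have h4 := green_coef_le lam w.
rewrite -[leLHS]mul1r ler_pdivrMr ?mulr_gt0 ?expR_gt0//.
by rewrite -[leLHS]h1 ler_pM2l//; lra.
Qed.

Lemma ln_hit_ge lam w : beta < lam -> lam - beta <= - ln (hit lam w).
Proof.
move=> bl; rewrite lerNr -[leRHS]expRK ler_ln ?posrE ?expR_gt0 ?hit_gt0//.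
by have /andP[] := hit_le w bl.
Qed.

Lemma ln_hit_bound lam w : beta < lam -> `|- ln (hit lam w)| <= ln (2 * expR lam).
Proof.
move=> bl; rewrite ger0_norm; last first.
  by rewrite (le_trans _ (ln_hit_ge w bl))// subr_ge0 ltW.
rewrite lerNl -lnV ?posrE ?mulr_gt0 ?expR_gt0//.
by rewrite ler_ln ?posrE ?invr_gt0 ?mulr_gt0 ?expR_gt0 ?hit_gt0 ?hit_ge.
Qed.

Lemma measurable_ln_hit lam : beta < lam ->
  measurable_fun [set: Omega] (fun w => - ln (hit lam w)).
Proof.
move=> bl; apply: measurableT_comp => //; apply: measurableT_comp => //.
exact: measurable_hit.
Qed.

(** This is the source of the continuity of the exponent. A ratio [t = e^(- M s)] passes through
    each level of the continued fraction if [t (e^s - q) <= 1 - q], where [q] bounds all iterates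
    for parameters at least [lam0]. To first order in [s] this dictates [M = 1 / (1 - q)]. *)
Lemma hit_lipschitz lam0 lam lam' w : beta < lam0 -> lam0 <= lam -> lam <= lam' ->
  expR (- ((1 - expR (- (lam0 - beta)))^-1 * (lam' - lam))) * hit lam w <=
    hit lam' w <= hit lam w.
Proof.
move=> b0 b1 b2; have bl := lt_le_trans b0 b1; have bl' := lt_le_trans bl b2.
set q := expR (- (lam0 - beta)); set s := lam' - lam.
have s0 : 0 <= s by rewrite subr_ge0.
have q0 : 0 < q by exact: expR_gt0.
have q1 : q < 1 by rewrite expR_lt1 oppr_lt0 subr_gt0.
set M := (1 - q)^-1; have M0 : 0 < M by rewrite invr_gt0 subr_gt0.
have Mq : (1 - q) * M = 1 by rewrite divff// gt_eqF// subr_gt0.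
set t := expR (- (M * s)); have t0 : 0 < t by exact: expR_gt0.
have t1 : t <= 1 by rewrite -expR0 ler_expR oppr_le0 mulr_ge0// ltW.
have es1 : 1 <= expR s by rewrite -expR0 ler_expR.
have key : t * (expR s - q) <= 1 - q.
  have tE : t * expR (M * s) = 1 by rewrite -expRD addNr expR0.
  have -> : 1 - q = t * ((1 - q) * expR (M * s)) by rewrite mulrCA tE mulr1.
  rewrite ler_pM2l//.
  have h1 : expR (M * s) = expR s * expR ((M - 1) * s).
    by rewrite -expRD; congr expR; ring.
  have h2 := expR_ge1Dx ((M - 1) * s); have h3 := expR_ge1Dx (- s).
  have h4 : expR s * expR (- s) = 1 by rewrite -expRD subrr expR0.
  have h5 : expR s * (1 - s) <= 1 by rewrite -[leRHS]h4 ler_pM2l ?expR_gt0.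
  have h6 : q * (expR s * (1 - s)) <= q by rewrite ler_piMr// ltW.
  have h7 : (1 - q) * (expR s * (1 + (M - 1) * s)) <= (1 - q) * expR (M * s).
    by rewrite h1 ler_pM2l ?subr_gt0// ler_pM2l ?expR_gt0.
  apply: le_trans h7.
  have -> : (1 - q) * (expR s * (1 + (M - 1) * s)) =
    expR s * (1 - q + ((1 - q) * M - (1 - q)) * s) by ring.
  by rewrite Mq; move: h6; set e := expR s; nra.
have aE v : green_coef lam' v = expR s * green_coef lam v.
  by rewrite /green_coef mulrCA -expRD; congr (_ * expR _); rewrite /s; ring.
have iter n v : t * hit_iter lam n v <= hit_iter lam' n v <= hit_iter lam n v.
  elim: n v => [|n IH] v; first by rewrite /= mulr0 lexx.
  have /andP[h1 h2] := IH (Tinv v).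
  have p1 := green_sub_gt0 n v bl; have p2 := green_sub_gt0 n v bl'.
  have a2 : 2 <= green_coef lam v.
    rewrite (le_trans _ (green_coef_ge _ _))// ler_peMr//.
    by rewrite ltW// expR_gt1 subr_gt0.
  have /andP[y0 y1] := hit_iter_itv n (Tinv v) bl.
  have yq : hit_iter lam n (Tinv v) <= q.
    by rewrite (le_trans y1)// ler_expR lerN2 lerD2r.
  rewrite !hit_iterS.
  move: p1 p2 h1 h2 a2 y0 yq; rewrite aE.
  set a := green_coef lam v; set y := hit_iter lam n _; set y' := hit_iter lam' n _.
  set E := expR s in es1 key * => p1 p2 h1 h2 a2 y0 yq.
  rewrite ler_pdivrMr// lef_pV2 ?posrE//; apply/andP; split; last first.
    have : a <= E * a by rewrite ler_peMl//; lra.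
    lra.
  rewrite mulrC ler_pdivlMr//.
  have k1 : t * (E * a - y') <= t * (E * a - t * y) by rewrite ler_pM2l//; lra.
  apply: le_trans k1 _.
  (* The difference [a - y - t (E a - t y)] is exactly the sum of the nonnegative terms [k2] to
     [k5], which encode [key], [y <= q], [a >= 2] and a square. *)
  have k2 : 0 <= a * (1 - q - t * (E - q)) by rewrite mulr_ge0 ?subr_ge0//; lra.
  have k3 : 0 <= (q - y) * (1 - t ^+ 2).
    by rewrite mulr_ge0 ?subr_ge0// expr_le1// ltW.
  have k4 : 0 <= (a - 2) * (q * (1 - t)).
    by rewrite mulr_ge0 ?subr_ge0// mulr_ge0 ?subr_ge0// ltW.
  have k5 : 0 <= q * (1 - t) ^+ 2 by rewrite mulr_ge0 ?sqr_ge0// ltW.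
  rewrite -subr_ge0; apply: le_trans (addr_ge0 (addr_ge0 k2 k3) (addr_ge0 k4 k5)) _.
  rewrite le_eqVlt; apply/orP; left; apply/eqP; ring.
have c := @hit_cvg lam w bl; have c' := @hit_cvg lam' w bl'.
have ct : (fun n => t * hit_iter lam n w) @ \oo --> t * hit lam w.
  by apply: cvgM => //; exact: cvg_cst.
apply/andP; split.
  by apply: (ler_cvg_to ct c'); apply: nearW => n; have /andP[] := iter n w.
by apply: (ler_cvg_to c' c); apply: nearW => n; have /andP[] := iter n w.
Qed.

End HittingTransform.

(** * Lyapunov exponents *)

(** The solutions form a plane; the ratio bound selects the one growing to the right. The
    asymptotics are two-sided: [F] decays to the left at the same rate, so that one function serves
    starting points of either sign. *)
Record growth_solution (R : realType) (beta lam : R) (W : int -> R) (G : R)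
    (F : int -> R) : Prop := GrowthSolution {
  growth_gt0 : forall k, 0 < F k;
  growth_eq : forall k, F (k + 1) + F (k - 1) = 2 * expR (lam - beta * W k) * F k;
  growth_ratio : forall k, F k <= expR (- (lam - beta)) * F (k + 1);
  growth_asymp : asymp_linear (fun k => ln (F k)) G }.

(* [F (x + 1) E x - F x E (x + 1)] is constant for two solutions [F], [E] of
   the same recursion; it is comparable to [F (x + 1) E x], which is therefore
   bounded, so that the two exponents agree. *)
Lemma growth_exponent_unique (R : realType) (beta lam : R) (W : int -> R)
    (G G' : R) (F F' : int -> R) : beta < lam ->
  growth_solution beta lam W G F ->
  growth_solution beta lam (fun k => W (- k)) G' F' -> G = G'.
Proof.
move=> bl [F0 FE Fr FG] [F'0 F'E F'r F'G].
pose E (k : int) := F' (- k).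
have E0 (k : int) : 0 < E k by exact: F'0.
have EE (k : int) : E (k + 1) + E (k - 1) = 2 * expR (lam - beta * W k) * E k.
  by rewrite /E opprD opprB addrC -[1 - k]addrC F'E opprK.
have Er (k : int) : E (k + 1) <= expR (- (lam - beta)) * E k.
  by have := F'r (- (k + 1)); rewrite (_ : - (k + 1) + 1 = - k) //; lia.
set q := expR (- (lam - beta)) in Fr Er.
have q0 : 0 < q by exact: expR_gt0.
have q1 : q < 1 by rewrite expR_lt1 oppr_lt0 subr_gt0.
pose D (k : int) := F (k + 1) * E k - F k * E (k + 1).
have DS (k : int) : D (k + 1) = D k.
  rewrite /D; have := FE (k + 1); have := EE (k + 1); rewrite addrK => e1 f1.
  have -> : E (k + 1 + 1) = 2 * expR (lam - beta * W (k + 1)) * E (k + 1) - E k.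
    by rewrite -e1 addrK.
  have -> : F (k + 1 + 1) = 2 * expR (lam - beta * W (k + 1)) * F (k + 1) - F k.
    by rewrite -f1 addrK.
  ring.
have Dn (n : nat) : D n%:Z = D 0.
  by elim: n => // n IH; rewrite -addn1 PoszD DS.
have Dlow (k : int) : (1 - q ^+ 2) * (F (k + 1) * E k) <= D k.
  rewrite /D mulrBl mul1r lerD2l lerN2 expr2.
  have -> : q * q * (F (k + 1) * E k) = (q * F (k + 1)) * (q * E k) by ring.
  by apply: ler_pM => //; exact: ltW.
have Dup (k : int) : D k <= F (k + 1) * E k.
  by rewrite gerBl mulr_ge0// ltW.
have q20 : 0 < 1 - q ^+ 2 by rewrite subr_gt0 exprn_ilt1// ltW.
have D0 : 0 < D 0.
  by apply: lt_le_trans (Dlow 0); rewrite !mulr_gt0.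
have lnFE (n : nat) : ln (D 0) <= ln (F (n%:Z + 1)) + ln (E n%:Z) <=
    ln (D 0 / (1 - q ^+ 2)).
  have FE0 : 0 < F (n%:Z + 1) * E n%:Z by rewrite mulr_gt0.
  rewrite -lnM ?posrE// !ler_ln ?posrE ?divr_gt0//.
  by rewrite -(Dn n) Dup /= ler_pdivlMr// mulrC Dlow.
have main e : 0 < e -> exists C : R, forall n : nat, `|n%:R * (G - G')| <= e * n%:R + C.
  move=> e0; have [K1 H1] := FG (e / 2) (divr_gt0 e0 (ltr0n _ 2)).
  have [K2 H2] := F'G (e / 2) (divr_gt0 e0 (ltr0n _ 2)).
  exists (`|ln (D 0)| + `|ln (D 0 / (1 - q ^+ 2))| + e + `|G| + K1 + K2); move=> j.
  have /andP[b1 b2] := lnFE j.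
  have := H1 (j%:Z + 1); have := H2 (- j%:Z); rewrite -/(E j%:Z).
  rewrite mulrNz normrN mulNr opprK -[j%:~R]/(j%:R) intrD -[j%:~R]/(j%:R).
  rewrite -[1%:~R]/(1%:R) -natrD !normr_nat natrD.
  move: b1 b2; move: (ln (F _)) (ln (E _)) (ln (D 0)) (ln (D 0 / _)) => f g a b.
  have := ler_norm (- a); have := ler_norm b; have := ler_norm G.
  have := ler_norm (- G); rewrite !normrN.
  have := normr_ge0 a; have := normr_ge0 b; move: (j%:R : R) (ler0n R j) => x x0.
  move=> ? ? ? ? ? ? ? ? /ler_normlP[h1 h2] /ler_normlP[h3 h4].
  by apply/ler_normlP; split; nra.
apply/eqP; rewrite -subr_eq0; apply/negPn/negP => GG.
have e0 : 0 < `|G - G'| / 2 by rewrite divr_gt0// normr_gt0.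
have [C HC] := main _ e0; have := HC (Num.truncn (C / (`|G - G'| / 2))).+1.
have := truncnS_gt (C / (`|G - G'| / 2)); move: (Num.truncn _).+1 => n.
rewrite ltr_pdivrMr// normrM normr_nat; move: (n%:R : R) (`|_|) => x g.
lra.
Qed.

Section Lyapunov.
Context (R : realType) (d : measure_display) (Omega : measurableType d).
Variables (P : probability Omega R) (V : Omega -> R) (beta : R).
Hypotheses (mV : measurable_fun [set: Omega] V) (V01 : forall w, 0 <= V w <= 1).
Hypothesis beta0 : 0 <= beta.

(** [- ln hit] is the increment of [ln F] per site for the growing solution, so its mean is the
    Lyapunov exponent of the recursion. *)
Definition lyapunov (Tinv : Omega -> Omega) (lam : R) : R :=
  \int[P]_w - ln (hit Tinv V beta lam w).

Lemma ln_hit_integrable (Tinv : Omega -> Omega) (lam : R) :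
  measurable_fun [set: Omega] Tinv -> beta < lam ->
  P.-integrable [set: Omega] (EFin \o (fun w => - ln (hit Tinv V beta lam w))).
Proof.
move=> mTinv bl; apply: (@bounded_integrable _ _ _ _ _ (ln (2 * expR lam))).
  exact: measurable_ln_hit.
by move=> w; exact: ln_hit_bound.
Qed.

Lemma Rintegral_cst_prob (c : R) : \int[P]_w c = c.
Proof.
rewrite Rintegral_cst//; have -> : fine (P [set: Omega]) = 1.
  by have := @probability_setT _ _ _ P => ->.
by rewrite mulr1.
Qed.

Lemma cst_integrable (c : R) : P.-integrable [set: Omega] (EFin \o (fun=> c)).
Proof. by apply: (@bounded_integrable _ _ _ _ _ `|c|). Qed.

Lemma lyapunov_ge (Tinv : Omega -> Omega) (lam : R) :
  measurable_fun [set: Omega] Tinv -> beta < lam ->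
  lam - beta <= lyapunov Tinv lam.
Proof.
move=> mTinv bl; rewrite -[leLHS]Rintegral_cst_prob.
apply: le_Rintegral => //; first exact: cst_integrable.
  exact: ln_hit_integrable.
by move=> w _; exact: ln_hit_ge.
Qed.

Lemma lyapunov_lipschitz (Tinv : Omega -> Omega) (lam0 lam lam' : R) :
  measurable_fun [set: Omega] Tinv -> beta < lam0 -> lam0 <= lam -> lam <= lam' ->
  lyapunov Tinv lam <= lyapunov Tinv lam' <=
    lyapunov Tinv lam + (1 - expR (- (lam0 - beta)))^-1 * (lam' - lam).
Proof.
move=> mTinv b0 b1 b2; have bl := lt_le_trans b0 b1; have bl' := lt_le_trans bl b2.
have H w := hit_lipschitz Tinv V01 beta0 w b0 b1 b2.
have h w := hit_gt0 Tinv V01 beta0 w bl.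
have h' w := hit_gt0 Tinv V01 beta0 w bl'.
apply/andP; split.
  apply: le_Rintegral => //; [exact: ln_hit_integrable..|move=> w _].
  by rewrite lerN2 ler_ln ?posrE//; have /andP[] := H w.
rewrite -[X in _ + X]Rintegral_cst_prob -RintegralD//; last 2 first.
- exact: ln_hit_integrable.
- exact: cst_integrable.
apply: le_Rintegral => // [||w _].
- exact: ln_hit_integrable.
- apply: eq_integrable (integrableD measurableT (ln_hit_integrable mTinv bl)
    (cst_integrable _)) => // w _.
have /andP[+ _] := H w; rewrite -ler_ln ?posrE ?mulr_gt0 ?expR_gt0//.
by rewrite lnM ?posrE ?expR_gt0// expRK; lra.
Qed.

(** Intermediate values between [lam0] and [lam1]: the bound [lyapunov >= lam - beta] pushes the
    exponent past [th] at [beta + th]. *)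
Lemma lyapunov_surjective (Tinv : Omega -> Omega) (th lam0 : R) :
  measurable_fun [set: Omega] Tinv -> beta < lam0 -> lyapunov Tinv lam0 <= th ->
  exists2 lam, beta < lam & lyapunov Tinv lam = th.
Proof.
move=> mTinv b0 Gth; pose lam1 := Num.max lam0 (beta + th).
have b1 : lam0 <= lam1 by rewrite le_max lexx.
have th1 : th <= lyapunov Tinv lam1.
  rewrite (le_trans _ (lyapunov_ge mTinv (lt_le_trans b0 b1)))//.
  by rewrite lerBrDl le_max lexx orbT.
set M := (1 - expR (- (lam0 - beta)))^-1.
have M0 : 0 < M by rewrite invr_gt0 subr_gt0 expR_lt1 oppr_lt0 subr_gt0.
(* The exponent is controlled only for parameters above [beta]; freezing it to the left of [lam0]
   gives a function that is Lipschitz on the whole line. *)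
pose g x := lyapunov Tinv (Num.max lam0 x).
have glip x y : `|g x - g y| <= M * `|x - y|.
  wlog xy : x y / x <= y.
    move=> H; have [/H//|/ltW /H h] := leP x y.
    by rewrite distrC (distrC x y); exact: h.
  have m0 : lam0 <= Num.max lam0 x by rewrite le_max lexx.
  have m1 : Num.max lam0 x <= Num.max lam0 y.
    by rewrite ge_max !le_max lexx xy orbT.
  have /andP[h1 h2] := lyapunov_lipschitz mTinv b0 m0 m1.
  rewrite distrC ger0_norm ?subr_ge0// distrC [in leRHS]ger0_norm ?subr_ge0//.
  rewrite lerBlDl (le_trans h2)// lerD2l -/M ler_pM2l//.
  have hx : x <= Num.max lam0 x by rewrite le_max lexx orbT.
  by rewrite lerBlDr ge_max; rewrite ler_wpDl ?subr_ge0//= -addrA lerDl addrC subr_ge0.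
have cg : continuous g.
  move=> x; apply/cvgrPdist_le => e e0; near=> y.
  rewrite (le_trans (glip x y))// -ler_pdivlMl// mulrC.
  near: y; have := @cvg_id _ (nbhs x); rewrite -[X in X --> _]/(id y @[y --> x]).
  by move=> /cvgrPdist_le; apply; rewrite divr_gt0.
have thI : Num.min (g lam0) (g lam1) <= th <= Num.max (g lam0) (g lam1).
  rewrite /g maxxx (max_idPr b1).
  have G01 := le_trans Gth th1.
  by rewrite (min_idPl G01) (max_idPr G01) Gth th1.
have [lam] := IVT b1 (continuous_subspaceT cg) thI.
rewrite in_itv /= => /andP[l0 l1]; rewrite /g (max_idPr l0) => Gl.
by exists lam => //; exact: lt_le_trans l0.
Unshelve. all: by end_near. Qed.

(** [F] is the exponential of the cocycle of [- ln hit], so [hit] is the ratio of consecutive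
    values. Multiplied by [F (k + 1)], the equation [hitE] becomes the recursion, and Birkhoff gives
    the exponent. *)
Lemma growth_solution_ae (T Tinv : Omega -> Omega)
    (TK : cancel T Tinv) (TinvK : cancel Tinv T)
    (T_mp : measure_preserving P T) (Tinv_mp : measure_preserving P Tinv)
    (T_erg : ergodic P T) (Tinv_erg : ergodic P Tinv) (lam : R) :
  beta < lam ->
  {ae P, forall w, exists F, growth_solution beta lam
     (fun k => V (iterT T Tinv k w)) (lyapunov Tinv lam) F}.
Proof.
move=> bl; have [mTinv _] := Tinv_mp.
have := birkhoff_int TK TinvK T_mp Tinv_mp T_erg Tinv_erg
  (measurable_ln_hit mTinv mV V01 beta0 bl)
  (fun w => ln_hit_bound Tinv V01 beta0 w bl).
apply: filterS => w Hw.
pose S k := isum T Tinv (fun w => - ln (hit Tinv V beta lam w)) k w.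
have SS k : expR (S (k + 1)) * hit Tinv V beta lam (iterT T Tinv k w) = expR (S k).
  rewrite /S isum_succ expRD expRN lnK ?posrE ?hit_gt0//.
  by rewrite mulfVK// gt_eqF// hit_gt0.
exists (fun k => expR (S k)); split.
- by move=> k; exact: expR_gt0.
- move=> k; have s1 := SS k; have := SS (k - 1).
  rewrite subrK iterT_pred// => <-; rewrite -s1; set e := expR _.
  have := hitE Tinv V01 beta0 (iterT T Tinv k w) bl.
  set p := hit _ _ _ _ _; set p' := hit _ _ _ _ _ => h.
  have he : e * (p * (green_coef V beta lam (iterT T Tinv k w) - p')) = e.
    by rewrite h mulr1.
  by rewrite -[X in X + _]he /green_coef; ring.
- move=> k; rewrite -SS mulrC ler_pM2r ?expR_gt0//.
  by have /andP[] := hit_le Tinv V01 beta0 (iterT T Tinv k w) bl.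
- move=> e e0; have [K HK] := Hw e e0; exists K => k; rewrite expRK; exact: HK.
Qed.

End Lyapunov.

(** * Staying near a point: lower bound *)

Section DriftConstants.
Variables (R : realType) (delta c : R).
Hypothesis delta01 : 0 < delta < 1.
Hypothesis cE : c = 2^-1 * ln ((1 + delta) / (1 - delta)).

Lemma cosh_gt0 (x : R) : 0 < cosh x.
Proof. by rewrite /cosh divr_gt0// addr_gt0 ?expR_gt0. Qed.

Lemma expR_drift : expR c = (1 + delta) * cosh c.
Proof.
have /andP[d0 d1] := delta01.
have p : 0 < (1 + delta) / (1 - delta) by rewrite divr_gt0; lra.
have e2 : expR c * expR c * (1 - delta) = 1 + delta.
  rewrite -expRD cE -mulrDl (_ : 2^-1 + 2^-1 = 1 :> R); last by field.
  rewrite mul1r lnK ?posrE//.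
  by rewrite divfK// gt_eqF//; lra.
have E0 := expR_gt0 c; rewrite /cosh expRN.
apply: (mulIf (x := 2 * expR c)); first by rewrite gt_eqF// mulr_gt0.
have -> : (1 + delta) * ((expR c + (expR c)^-1) / 2) * (2 * expR c) =
    (1 + delta) * (expR c * expR c + 1).
  by field; rewrite gt_eqF.
by move: e2; lra.
Qed.

Lemma expRN_drift : expR (- c) = (1 - delta) * cosh c.
Proof.
have : expR c + expR (- c) = 2 * cosh c by rewrite /cosh mulrC divfK.
by rewrite expR_drift; lra.
Qed.

Lemma cosh_drift : (1 - delta) * (1 + delta) * (cosh c * cosh c) = 1.
Proof.
have : expR (- c) * expR c = 1 by rewrite -expRD addNr expR0.
by rewrite expR_drift expRN_drift => h; rewrite -[RHS]h; ring.
Qed.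

Lemma drift_gt0 : 0 < c.
Proof.
have /andP[d0 d1] := delta01.
rewrite cE mulr_gt0 ?invr_gt0// ln_gt0// ltr_pdivlMr; lra.
Qed.

Lemma cosh_ge1 : 1 <= cosh c.
Proof.
have := cosh_drift; have := cosh_gt0 c.
have /andP[d0 d1] := delta01; set C := cosh c => C0 h.
rewrite leNgt; apply/negP => C1.
have : C * C < 1 by rewrite -[ltRHS]mulr1 ltr_pM// ltW.
have : 0 < C * C by rewrite mulr_gt0.
nra.
Qed.

Lemma ln_cosh_ge0 : 0 <= ln (cosh c).
Proof. exact/ln_ge0/cosh_ge1. Qed.

End DriftConstants.

Lemma kernel_ok_itv (R : realType) (delta : R) n (p : 'I_n -> int -> bool -> R) i y :
  kernel_ok delta p ->
  [/\ p i y false = 1 - p i y true, (1 - delta) / 2 <= p i y true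
    & p i y true <= (1 + delta) / 2].
Proof.
move=> /(_ i y)[_ e /ler_normlP[h1 h2]]; split; lra.
Qed.

Lemma kernel_ok_ge0 (R : realType) (delta : R) n (p : 'I_n -> int -> bool -> R) :
  kernel_ok delta p -> forall i y b, 0 <= p i y b.
Proof. by move=> pk i y b; have [/(_ b)/andP[]] := pk i y. Qed.

(** Functions of the distance to [y] are evaluated at [x] and both neighbours; one case analysis
    rewrites the three distances together. *)
Variant radial_spec (x y : int) : nat -> nat -> nat -> Type :=
  | RadialCenter of x = y : radial_spec x y 0 1 1
  | RadialRight n of y < x : radial_spec x y n.+1 n.+2 n
  | RadialLeft n of x < y : radial_spec x y n.+1 n n.+2.

Lemma radialP (x y : int) :
  radial_spec x y (absz (x - y)%R) (absz (x + 1 - y)%R) (absz (x - 1 - y)%R).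
Proof.
case E : (x - y) => [[|n]|n].
- have xy : x = y by lia.
  by rewrite xy addrAC subrr add0r addrAC subrr add0r; constructor.
- have -> : absz (x + 1 - y)%R = n.+2 by lia.
  have -> : absz (x - 1 - y)%R = n by lia.
  by constructor; lia.
- have -> : absz (x + 1 - y)%R = n by lia.
  have -> : absz (x - 1 - y)%R = n.+2 by lia.
  by constructor; lia.
Qed.

Section StayLowerBound.
Variables (R : realType) (delta c : R).
Hypothesis delta01 : 0 < delta < 1.
Hypothesis cE : c = 2^-1 * ln ((1 + delta) / (1 - delta)).

Let K := (1 - delta) / delta.

(* [j] is the distance to the centre. [e^(-cj)] is the eigenfunction of an
   outward drift; since [(K + 2) / K = e^(2c)], the product with the parabola
   decreases in [j], so that the outward drift is indeed the worst one. *)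
Definition bump_in (m : nat) (j : R) : R := expR (- (c * j)) * ((j + K) * (m%:R + 1 - j)).

(* The exponential tail pays for the way to the interval. *)
Definition bump (m : nat) (kappa : R) (j : nat) : R :=
  Num.max (bump_in m j%:R) (K * (m%:R + 1) * expR (- (kappa * j%:R))).

Let K0 : 0 < K.
Proof. by have /andP[d0 d1] := delta01; rewrite divr_gt0// subr_gt0. Qed.

Let KE : K * delta = 1 - delta.
Proof. by have /andP[d0 d1] := delta01; rewrite divfK// gt_eqF. Qed.

Lemma bump_gt0 m kappa j : 0 < bump m kappa j.
Proof.
rewrite lt_max; apply/orP; right; apply: mulr_gt0 (expR_gt0 _).
by apply: (mulr_gt0 K0); rewrite ltr_wpDl.
Qed.

(** By [mono] the outward extreme of [q] is the worst. There the exponential contributes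
    [1 / cosh c], and the parabola, averaged with equal weights, loses exactly 1. As it is at least
    [m] on [1 <= j <= m], the relative loss is at most [1 / m]. *)
Lemma bump_in_sub (m : nat) (j q : R) : (0 < m)%N -> 1 <= j <= m%:R ->
  (1 - delta) / 2 <= q <= (1 + delta) / 2 ->
  (1 - m%:R^-1) / cosh c * bump_in m j <=
    q * bump_in m (j + 1) + (1 - q) * bump_in m (j - 1).
Proof.
move=> m0 /andP[j1 jm] /andP[q1 q2]; have /andP[d0 d1] := delta01.
have k0 : 0 < K := K0; have ke : K * delta = 1 - delta := KE.
have C0 := cosh_gt0 c.
have Ep : expR (- (c * (j + 1))) = expR (- (c * j)) * ((1 - delta) * cosh c).
  by rewrite -(expRN_drift delta01 cE) -expRD; congr expR; ring.
have En : expR (- (c * (j - 1))) = expR (- (c * j)) * ((1 + delta) * cosh c).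
  by rewrite -(expR_drift delta01 cE) -expRD; congr expR; ring.
have e0 := expR_gt0 (- (c * j)).
have M1 : 1 <= m%:R :> R by rewrite ler1n.
rewrite /bump_in Ep En; set e := expR (- (c * j)) in e0 *.
have CC : (cosh c)^-1 = (1 - delta) * (1 + delta) * cosh c.
  apply: (mulIf (x := cosh c)); first by rewrite gt_eqF.
  by rewrite mulVf ?gt_eqF// -[LHS](cosh_drift delta01 cE); ring.
rewrite CC; set C := cosh c in C0 *; set M := m%:R in jm M1 *.
have fj : M <= (j + K) * (M + 1 - j).
  have : 0 <= (j - 1) * (M - j) by rewrite mulr_ge0; lra.
  have : 0 <= K * (M + 1 - j) by rewrite mulr_ge0; lra.
  lra.
have mono : (1 - delta) * ((j + 1 + K) * (M + 1 - (j + 1))) <=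
    (1 + delta) * ((j - 1 + K) * (M + 1 - (j - 1))).
  have h1 : (1 - delta) * (j + 1 + K) <= (1 + delta) * (j - 1 + K).
    have : 0 <= delta * (j - 1) by rewrite mulr_ge0; lra.
    by lra.
  have h2 : 0 <= (1 - delta) * (j + 1 + K) by rewrite mulr_ge0; lra.
  have h3 : M + 1 - (j + 1) <= M + 1 - (j - 1) by lra.
  have h4 : 0 <= M + 1 - (j + 1) by lra.
  by rewrite !mulrA; apply: ler_pM.
set A := (1 - delta) * _ in mono; set B := (1 + delta) * _ in mono.
have -> : q * (e * ((1 - delta) * C) * ((j + 1 + K) * (M + 1 - (j + 1)))) +
  (1 - q) * (e * ((1 + delta) * C) * ((j - 1 + K) * (M + 1 - (j - 1)))) =
  e * C * (q * A + (1 - q) * B) by rewrite /A /B; ring.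
have -> : (1 - M^-1) * ((1 - delta) * (1 + delta) * C) *
    (e * ((j + K) * (M + 1 - j))) = e * C * ((1 - M^-1) *
    ((1 - delta) * (1 + delta)) * ((j + K) * (M + 1 - j))) by ring.
rewrite (ler_pM2l (mulr_gt0 e0 C0)).
have : 0 <= ((1 + delta) / 2 - q) * (B - A) by rewrite mulr_ge0; lra.
have AB : (1 + delta) / 2 * A + (1 - delta) / 2 * B =
    (1 - delta) * (1 + delta) * ((j + K) * (M + 1 - j) - 1) by rewrite /A /B; field.
have : (1 - M^-1) * ((j + K) * (M + 1 - j)) <= (j + K) * (M + 1 - j) - 1.
  rewrite mulrBl mul1r lerD2l lerN2 mulrC ler_pdivlMr ?mul1r//; lra.
set f := (j + K) * _ in AB * => h.
have : (1 - delta) * (1 + delta) * ((1 - M^-1) * f) <=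
    (1 - delta) * (1 + delta) * (f - 1).
  by rewrite ler_wpM2l// mulr_ge0; lra.
rewrite -AB => *; lra.
Qed.

(** At the centre both neighbours are at distance 1, so every policy yields the same average. *)
Lemma bump_in0_sub (m : nat) : (0 < m)%N ->
  (1 - m%:R^-1) / cosh c * bump_in m 0 <= bump_in m 1.
Proof.
move=> m0; have /andP[d0 d1] := delta01; have C0 := cosh_gt0 c.
have k0 : 0 < K := K0; have ke : K * delta = 1 - delta := KE.
have M1 : 1 <= m%:R :> R by rewrite ler1n.
rewrite /bump_in mulr0 oppr0 expR0 mulr1 mul1r (expRN_drift delta01 cE).
rewrite mulrAC ler_pdivrMr//.
have -> : (1 - delta) * cosh c * ((1 + K) * (m%:R + 1 - 1)) * cosh c =
   (1 - delta) * (cosh c * cosh c) * ((1 + K) * m%:R) by ring.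
have h : (1 - delta) * (cosh c * cosh c) * (1 + delta) = 1.
  by rewrite -[RHS](cosh_drift delta01 cE); ring.
have {}h : (1 - delta) * (cosh c * cosh c) = (1 + delta)^-1.
  by apply: (mulIf (x := 1 + delta)); rewrite ?h ?mulVf// gt_eqF//; lra.
rewrite h [leRHS]mulrC ler_pdivlMr; last lra.
move: (m%:R : R) M1 => M M1.
have M0 : 0 < M by lra.
have -> : (1 - M^-1) * ((0 + K) * (M + 1 + 0)) * (1 + delta) =
    K * (1 + delta) * (M - M^-1) by field; rewrite gt_eqF.
have -> : 1 + K = K * (1 + delta) + delta by rewrite mulrDr KE; ring.
have MV : 0 < M^-1 by rewrite invr_gt0.
have : 0 <= K * (1 + delta) * M^-1 by apply: mulr_ge0; [apply: mulr_ge0; lra|lra].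
have : 0 <= delta * M by apply: mulr_ge0; lra.
lra.
Qed.

End StayLowerBound.

Section StayLowerBound.
Variables (R : realType) (delta c : R).
Hypothesis delta01 : 0 < delta < 1.
Hypothesis cE : c = 2^-1 * ln ((1 + delta) / (1 - delta)).

Local Notation K := ((1 - delta) / delta).

(** A maximum of subsolutions is a subsolution, checked on the branch that attains it. The tail
    needs only [W >= 0]: an inward step has probability at least [(1 - delta) / 2] and multiplies it
    by [e^kappa]. *)
Lemma bump_sub (beta h kappa rho : R) (m n : nat) (W : int -> R) (y : int)
    (p : 'I_n -> int -> bool -> R) (i : 'I_n) (x : int) :
  0 <= beta -> (0 < m)%N -> (forall k, 0 <= W k) ->
  (forall k : int, (absz (k - y)%R <= m)%N -> h <= W k) -> kernel_ok delta p ->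
  rho = expR (beta * h) * ((1 - m%:R^-1) / cosh c) ->
  0 <= kappa -> rho <= (1 - delta) / 2 * expR kappa ->
  rho * bump delta c m kappa (absz (x - y)%R) <= expR (beta * W x) *
    (p i x true * bump delta c m kappa (absz (x + 1 - y)%R) +
     p i x false * bump delta c m kappa (absz (x - 1 - y)%R)).
Proof.
move=> beta0 m0 W0 Wh pk rhoE kap0 rhok.
have /andP[d0 d1] := delta01; have k0 : 0 < K by rewrite divr_gt0// subr_gt0.
have [-> q1 q2] := kernel_ok_itv i x pk; set q := p i x true in q1 q2 *.
have C0 := cosh_gt0 c.
have m1 : 0 <= (1 - m%:R^-1) / cosh c.
  rewrite divr_ge0 ?(ltW C0)// subr_ge0 invf_le1 ?ltr0n// ler1n //.
have ew1 : 1 <= expR (beta * W x) by rewrite -expR0 ler_expR mulr_ge0.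
have b0 (j : nat) : 0 < bump delta c m kappa j by exact: bump_gt0.
have bin (j : nat) : bump_in delta c m j%:R <= bump delta c m kappa j by rewrite le_max lexx.
have inside (A : R) : 0 <= A -> (absz (x - y)%R <= m)%N ->
    expR (beta * h) * A <= expR (beta * W x) * A.
  by move=> A0 xm; rewrite ler_wpM2r// ler_expR ler_wpM2l// Wh.
have far (j : nat) (t : R) : (1 - delta) / 2 <= t <= (1 + delta) / 2 ->
    bump delta c m kappa j.+1 =
      K * (m%:R + 1) * expR (- (kappa * j.+1%:R)) ->
    rho * bump delta c m kappa j.+1 <= expR (beta * W x) *
      (t * bump delta c m kappa j.+2 + (1 - t) * bump delta c m kappa j).
  move=> /andP[t1 t2] E.
  have h1 : rho * bump delta c m kappa j.+1 <=
      (1 - delta) / 2 * expR kappa * bump delta c m kappa j.+1.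
    by rewrite ler_pM2r.
  have h2 : expR kappa * bump delta c m kappa j.+1 <= bump delta c m kappa j.
    rewrite E mulrCA -expRD.
    have -> : kappa + - (kappa * j.+1%:R) = - (kappa * j%:R).
      by rewrite -natr1; ring.
    by rewrite [leRHS]/bump le_max lexx orbT.
  have b2 := b0 j; have b3 := b0 j.+2.
  have h3 : (1 - delta) / 2 * (expR kappa * bump delta c m kappa j.+1) <=
      (1 - t) * bump delta c m kappa j.
    by apply: ler_pM => //; [lra|rewrite mulr_ge0 ?expR_ge0// ltW|lra].
  have h4 : 0 <= t * bump delta c m kappa j.+2 by rewrite mulr_ge0 ?(ltW b3)//; lra.
  have h5 : 0 <= (1 - t) * bump delta c m kappa j by rewrite mulr_ge0 ?(ltW b2)//; lra.
  rewrite (le_trans h1)// -mulrA (le_trans h3)//.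
  rewrite (le_trans (_ : _ <= 1 * (t * bump delta c m kappa j.+2 +
    (1 - t) * bump delta c m kappa j)))//.
    by rewrite mul1r lerDr.
  by rewrite ler_wpM2r// addr_ge0.
have near_ (j : nat) (t : R) : absz (x - y)%R = j.+1 ->
    (1 - delta) / 2 <= t <= (1 + delta) / 2 ->
    bump delta c m kappa j.+1 = bump_in delta c m j.+1%:R ->
    rho * bump delta c m kappa j.+1 <= expR (beta * W x) *
      (t * bump delta c m kappa j.+2 + (1 - t) * bump delta c m kappa j).
  move=> xj t12 E; have /andP[t1 t2] := t12.
  (* The bump is positive, so the parabola can attain the maximum only at distance at most [m],
     where [W >= h] is available. *)
  have jm : (j.+1 <= m)%N.
    rewrite leqNgt; apply/negP => mj; have := b0 j.+1; rewrite E /bump_in.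
    rewrite pmulr_rgt0 ?expR_gt0// pmulr_rgt0; last by rewrite addr_gt0.
    by rewrite subr_gt0 natr1 ltr_nat ltnNge mj.
  have h0 := bump_in_sub delta01 cE m0 (j := j.+1%:R) (q := t).
  have {}h0 := h0 _ t12; rewrite ler1n ler_nat jm in h0; have {}h0 := h0 isT.
  rewrite natr1 -[X in bump_in _ _ _ (X - 1)]natr1 addrK in h0.
  have h1 : t * bump_in delta c m j.+2%:R + (1 - t) * bump_in delta c m j%:R <=
      t * bump delta c m kappa j.+2 + (1 - t) * bump delta c m kappa j.
    by apply: lerD; apply: ler_wpM2l => //; lra.
  rewrite rhoE -mulrA E (le_trans (inside _ _ _)) ?xj//.
    by rewrite mulr_ge0// -E ltW.
  by rewrite ler_pM2l ?expR_gt0// (le_trans h0).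
have all_ j (t : R) : absz (x - y)%R = j.+1 ->
    (1 - delta) / 2 <= t <= (1 + delta) / 2 ->
    rho * bump delta c m kappa j.+1 <= expR (beta * W x) *
      (t * bump delta c m kappa j.+2 + (1 - t) * bump delta c m kappa j).
  move=> xj t12; pose A := bump_in delta c m j.+1%:R.
  pose B := K * (m%:R + 1) * expR (- (kappa * j.+1%:R)).
  have [AB|BA] := leP A B; first by apply: far => //; rewrite /bump (max_idPr AB).
  by apply: near_ => //; rewrite /bump (max_idPl (ltW BA)).
case: radialP inside all_ => [xy|j xy|j xy] inside all_.
- have e0 : bump delta c m kappa 0 = bump_in delta c m 0.
    by rewrite /bump /bump_in !mulr0 oppr0 expR0 mul1r mulr1 add0r addr0 maxxx.
  rewrite -mulrDl subrKC mul1r rhoE -mulrA e0.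
  rewrite (le_trans (inside _ _ _))//; first by rewrite mulr_ge0// -e0 ltW.
  rewrite ler_pM2l ?expR_gt0// (le_trans (bump_in0_sub delta01 cE m0))//.
  exact: (bin 1%N).
- by apply: all_ => //; rewrite q1.
- rewrite addrC -[X in _ + X * _](subKr 1); apply: all_ => //.
  by apply/andP; split; lra.
Qed.

(** Places the bump, up to a constant, below the terminal weight [e^(th x)], which may fall off at
    rate [|th|] away from the centre. *)
Lemma bump_le (th kappa : R) (m j : nat) : `|th| <= kappa ->
  bump delta c m kappa j <=
    (m%:R + 1 + K) * (m%:R + 1) * expR (`|th| * (m%:R + 1)) * expR (- (`|th| * j%:R)).
Proof.
have /andP[d0 d1] := delta01; have k0 : 0 < K by rewrite divr_gt0// subr_gt0.
have c0 := drift_gt0 delta01 cE.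
move=> thk; have t0 := normr_ge0 th; have m0 : 0 <= m%:R :> R by exact: ler0n.
have j0 : 0 <= j%:R :> R by exact: ler0n.
set A := (m%:R + 1 + K) * (m%:R + 1).
have A0 : 0 <= A by apply: mulr_ge0; lra.
have e1 : 1 <= expR (`|th| * (m%:R + 1)) by rewrite -expR0 ler_expR mulr_ge0// addr_ge0.
rewrite /bump ge_max; apply/andP; split; last first.
  rewrite -[leRHS]mulrA; apply: (@le_trans _ _ (A * expR (- (`|th| * j%:R)))); last first.
    by rewrite ler_wpM2l// ler_peMl// expR_ge0.
  apply: ler_pM; rewrite ?expR_ge0//; first by rewrite mulr_ge0// ?ltW// ltr_wpDl.
    by rewrite /A ler_wpM2r//; lra.
  by rewrite ler_expR lerN2 ler_wpM2r.
have [jm|mj] := leP j%:R (m%:R + 1 : R); last first.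
  apply: (@le_trans _ _ 0); last by rewrite !mulr_ge0 ?expR_ge0//; lra.
  have jK : 0 <= j%:R + K by lra.
  by rewrite /bump_in mulr_ge0_le0 ?expR_ge0// mulr_ge0_le0// subr_le0 ltW.
rewrite -[leRHS]mulrA -expRD; apply: (@le_trans _ _ (A * 1)); last first.
  rewrite ler_wpM2l// -[leLHS]expR0 ler_expR -mulrBr mulr_ge0// subr_ge0//.
rewrite mulr1 /bump_in -[leRHS]mul1r; apply: ler_pM; rewrite ?expR_ge0//.
- by rewrite mulr_ge0 ?subr_ge0// addr_ge0// ltW.
- by rewrite -expR0 ler_expR oppr_le0 mulr_ge0// ltW.
- by apply: ler_pM; rewrite ?subr_ge0//; move: k0; lra.
Qed.

(** The constants do not depend on [W], [y], [n] or [X]: the environment enters only through the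
    distance to a good interval, at the price [kappa] per site. *)
Lemma stay_lower_bound (beta th r : R) : 0 <= beta -> r < beta - ln (cosh c) ->
  exists (h : R) m (kappa D : R), [/\ 0 < h < 1, (0 < m)%N, 0 <= kappa &
    forall (W : int -> R) (y : int), (forall k, 0 <= W k) ->
    (forall k : int, (absz (k - y)%R <= m)%N -> h <= W k) ->
    forall n (p : 'I_n -> int -> bool -> R) (X : int), kernel_ok delta p ->
    expR (th * X%:~R - kappa * (absz (X - y)%R)%:R - D + n%:R * r) <=
      walk_exp beta W (fun x => expR (th * x%:~R)) p X].
Proof.
move=> beta0 rlt; have /andP[d0 d1] := delta01.
have k0 : 0 < K by rewrite divr_gt0// subr_gt0.
pose eta := beta - ln (cosh c) - r; have eta0 : 0 < eta by rewrite subr_gt0.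
have be0 : 0 < 2 * (beta + eta) by rewrite mulr_gt0//; lra.
(* Half of the gap [eta] goes to the height, [beta h >= beta - eta / 2], and half to the length,
   [1 - 1 / m >= e^(- eta / 2)]. The denominator keeps [h] in [(0, 1)] even for [beta = 0]. *)
pose h := 1 - eta / (2 * (beta + eta)).
have h01 : 0 < h < 1.
  have : 0 < eta / (2 * (beta + eta)) by rewrite divr_gt0.
  have : eta / (2 * (beta + eta)) < 1 by rewrite ltr_pdivrMr//; lra.
  by rewrite /h; move: (_ / _) => t t1 t0; apply/andP; split; lra.
have bh : beta - eta / 2 <= beta * h.
  rewrite /h mulrBr mulr1 lerD2l lerN2 mulrA ler_pdivrMr//.
  have : 0 <= eta * eta by rewrite mulr_ge0 ?ltW.
  lra.
pose z := expR (- (eta / 2)).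
have z1 : z < 1 by rewrite expR_lt1 oppr_lt0 divr_gt0.
pose m := (Num.truncn (1 - z)^-1).+1.
have mz : z <= 1 - m%:R^-1.
  rewrite lerBrDl -lerBrDr -[leRHS]invrK lef_pV2 ?posrE ?invr_gt0 ?subr_gt0// ?ltr0n//.
  by rewrite ltW// truncnS_gt.
have m0 : (0 < m)%N by [].
(* Chosen so that [(1 - delta) / 2 * e^kappa = e^(|th| + beta)], which dominates [rho], with
   [kappa >= |th|] for [bump_le]. The witness adds [|th|] for moving the weight from [y] to [X]. *)
clearbody m; pose kappa := `|th| + beta + ln (2 / (1 - delta)).
have l20 : 0 <= ln (2 / (1 - delta)) by rewrite ln_ge0// ler_pdivlMr; lra.
have kap0 : 0 <= kappa by rewrite !addr_ge0.
have thk : `|th| <= kappa by rewrite /kappa -addrA lerDl addr_ge0.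
pose C1 := (m%:R + 1 + K) * (m%:R + 1) * expR (`|th| * (m%:R + 1)).
have mp : 0 < m%:R + 1 :> R by rewrite ltr_wpDl.
have C10 : 0 < C1.
  by apply: mulr_gt0 (expR_gt0 _); apply: mulr_gt0 => //; rewrite addr_gt0.
pose D := ln C1 - ln (K * (m%:R + 1)).
exists h, m, (kappa + `|th|), D; split => //; first by rewrite addr_ge0.
move=> W y W0 Wh n p X pk; have p0 := kernel_ok_ge0 pk.
pose rho := expR (beta * h) * ((1 - m%:R^-1) / cosh c).
have C0 := cosh_gt0 c.
have rhoge : expR r <= rho.
  have -> : r = (beta - eta / 2) + (- (eta / 2)) - ln (cosh c) by rewrite /eta; field.
  rewrite 2!expRD (expRN (ln _)) lnK ?posrE// -mulrA; apply: ler_pM => //.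
  - by rewrite divr_ge0 ?expR_ge0 ?ltW.
  - by rewrite ler_expR.
  - by rewrite ler_pM2r ?invr_gt0.
have rhole : rho <= (1 - delta) / 2 * expR kappa.
  have -> : (1 - delta) / 2 * expR kappa = expR (`|th| + beta).
    rewrite /kappa expRD lnK ?posrE; last by rewrite divr_gt0//; lra.
    by field; rewrite gt_eqF//; lra.
  apply: (@le_trans _ _ (expR beta)); last by rewrite ler_expR lerDr.
  rewrite /rho -[leRHS]mulr1; apply: ler_pM; rewrite ?expR_ge0//.
  - by rewrite divr_ge0 ?(ltW C0)//; apply: le_trans mz; exact: expR_ge0.
  - by rewrite ler_expR ler_piMr//; have /andP[_ /ltW] := h01.
  - rewrite ler_pdivrMr// mul1r.
    have : 0 <= m%:R^-1 :> R by rewrite invr_ge0.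
    have := cosh_ge1 delta01 cE; lra.
have th_dist (x : int) : `|th * x%:~R - th * y%:~R| = `|th| * (absz (x - y)%R)%:R.
  by rewrite -mulrBr normrM -intrB -intr_norm.
have := @walk_exp_ge _ beta W (fun x => expR (th * x%:~R))
  (fun x => bump delta c m kappa (absz (x - y)%R))
  (expR (th * y%:~R) / C1) rho n p X.
move=> H; apply: le_trans (H _ p0 _ _ _).
- have a0 : 0 < K * (m%:R + 1) by rewrite mulr_gt0.
  have -> : expR (th * X%:~R - (kappa + `|th|) * (absz (X - y)%R)%:R - D + n%:R * r)
    = expR (th * X%:~R - `|th| * (absz (X - y)%R)%:R) / C1 * expR (n%:R * r) *
      (K * (m%:R + 1) * expR (- (kappa * (absz (X - y)%R)%:R))).
    rewrite -[in RHS](lnK C10) -[in X in _ = _ * (X * _)](lnK a0) -expRN -!expRD.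
    by congr expR; rewrite /D; ring.
  have C1V : 0 < C1^-1 by rewrite invr_gt0.
  have L1 : expR (th * X%:~R - `|th| * (absz (X - y)%R)%:R) / C1 <=
      expR (th * y%:~R) / C1.
    rewrite ler_pM2r// ler_expR.
    by have := ler_norm (th * X%:~R - th * y%:~R); rewrite th_dist; lra.
  have L2 : expR (n%:R * r) <= rho ^+ n.
    rewrite expRM_natl; apply: lerXn2r; rewrite // nnegrE ?expR_ge0//.
    by rewrite (le_trans _ rhoge)// expR_ge0.
  apply: ler_pM.
  + by rewrite mulr_ge0 ?expR_ge0// mulr_ge0 ?expR_ge0// ltW.
  + by rewrite mulr_ge0 ?expR_ge0// ltW.
  + by apply: ler_pM => //; rewrite ?expR_ge0 ?mulr_ge0 ?expR_ge0 ?(ltW C1V).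
  + by rewrite /bump le_max lexx orbT.
- by rewrite (le_trans _ rhoge)// expR_ge0.
- by move=> i x; exact: (bump_sub i x beta0 m0 W0 Wh pk erefl kap0 rhole).
- move=> x _; apply: le_trans (ler_wpM2l _ (bump_le m _ thk)) _.
    by rewrite divr_ge0 ?expR_ge0// ltW.
  rewrite -/C1 mulrA divfK ?gt_eqF// -expRD ler_expR.
  by have := ler_norm (th * y%:~R - th * x%:~R); rewrite distrC th_dist; lra.
- by rewrite divr_ge0 ?expR_ge0// ltW.
Qed.

End StayLowerBound.

(** * Steering to a point: upper bound *)

Section SeekUpperBound.
Variables (R : realType) (delta c : R).
Hypothesis delta01 : 0 < delta < 1.
Hypothesis cE : c = 2^-1 * ln ((1 + delta) / (1 - delta)).

Definition seek_policy (y x : int) (b : bool) : R :=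
  if x == y then 2^-1
  else if (y < x) (+) b then (1 + delta) / 2 else (1 - delta) / 2.

Lemma seek_policy_ok (y : int) n :
  kernel_ok delta (fun (_ : 'I_n) => seek_policy y).
Proof.
have /andP[d0 d1] := delta01.
move=> _ x; rewrite /seek_policy; case: eqP => _; first split.
- by move=> _; rewrite invr_ge0 ler0n invf_le1 ?ler1n.
- by rewrite -div1r -splitr.
- by rewrite subrr normr0 ltW.
case: (y < x); split => /=.
- by case=> /=; apply/andP; split; lra.
- lra.
- by apply/ler_normlP; split; lra.
- by case=> /=; apply/andP; split; lra.
- lra.
- by apply/ler_normlP; split; lra.
Qed.

(** Under inward drift [e^(c |k|)] is multiplied by [1 / cosh c] off the centre, so even with
    [W = 1] its rate is [beta - ln (cosh c)]. The constant 1 repairs the kink at the centre; inside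
    the interval it grows at a rate close to 0, which is acceptable because
    [beta - ln (cosh c) >= 0]. The bound [|th| <= c] puts the terminal weight below [e^(c |k|)]. *)
Lemma seek_upper_bound (beta th r : R) : 0 <= beta -> ln (cosh c) <= beta ->
  `|th| <= c -> beta - ln (cosh c) < r ->
  exists (h : R) m (kappa D : R), [/\ 0 < h < 1, (0 < m)%N, 0 <= kappa &
    forall (W : int -> R) (y : int), (forall k, W k <= 1) ->
    (forall k : int, (absz (k - y)%R <= m)%N -> W k <= h) ->
    forall n (X : int),
    walk_exp beta W (fun x => expR (th * x%:~R)) (fun (_ : 'I_n) => seek_policy y) X
    <= expR (th * X%:~R + kappa * (absz (X - y)%R)%:R + D + n%:R * r)].
Proof.
move=> beta0 betac thc rgt; have /andP[d0 d1] := delta01.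
have c0 := drift_gt0 delta01 cE; have C0 := cosh_gt0 c.
pose eta := r - (beta - ln (cosh c)); have eta0 : 0 < eta by rewrite subr_gt0.
have be0 : 0 < 2 * (beta + eta) by rewrite mulr_gt0//; lra.
pose h := eta / (2 * (beta + eta)).
have h0 : 0 < h by rewrite divr_gt0.
have h1 : h < 1 by rewrite /h ltr_pdivrMr//; lra.
have bh : beta * h <= eta / 2.
  rewrite /h mulrA ler_pdivrMr//.
  have : 0 <= eta * eta by rewrite mulr_ge0 ?ltW.
  lra.
(* Equivalent to [1 + b e^c = e^(eta / 2)]: one step away from the centre costs half of the
   slack. *)
pose b := (expR (eta / 2) - 1) / expR c.
have e21 : 0 < expR (eta / 2) - 1 by rewrite subr_gt0 expR_gt1 divr_gt0.
have b0 : 0 < b by rewrite divr_gt0 ?expR_gt0.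
have e1 : 0 < expR eta - 1 by rewrite subr_gt0 expR_gt1.
(* Beyond distance [m] the exponential outweighs the constant: [cosh c <= (e^eta - 1) b e^(c j)],
   obtained from [e^(c j) >= 1 + c j]. *)
pose m := (Num.truncn (cosh c / ((expR eta - 1) * b * c))).+1.
have mge : cosh c <= (expR eta - 1) * b * (c * m%:R).
  have p0 : 0 < (expR eta - 1) * b * c by exact: mulr_gt0 (mulr_gt0 e1 b0) c0.
  have := truncnS_gt (cosh c / ((expR eta - 1) * b * c)).
  rewrite ltr_pdivrMr// -/m => /ltW h2; apply: le_trans h2 _.
  by rewrite mulrC [leRHS]mulrA.
have m0 : (0 < m)%N by [].
clearbody m; have bE : b * expR c = expR (eta / 2) - 1.
  by rewrite divfK// gt_eqF ?expR_gt0.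
clearbody b; pose D := ln ((1 + b) / b).
exists h, m, (`|th| + c), D; split => //; first by rewrite h0.
  by rewrite addr_ge0// ltW.
move=> W y W1 Wh n X.
pose g (x : int) := 1 + b * expR (c * (absz (x - y)%R)%:R).
have th_dist (x : int) : `|th * x%:~R - th * y%:~R| = `|th| * (absz (x - y)%R)%:R.
  by rewrite -mulrBr normrM -intrB -intr_norm.
have rE : expR r = expR (beta + eta) / cosh c.
  rewrite -[X in _ / X]lnK ?posrE// -expRN -expRD; congr expR; rewrite /eta; ring.
have reta : expR eta <= expR r by rewrite ler_expR /eta; lra.
have sup x : expR (beta * W x) * (seek_policy y x true * g (x + 1) +
    seek_policy y x false * g (x - 1)) <= expR r * g x.
  rewrite /g /seek_policy.
  have far (j : nat) : absz (x - y)%R = j.+1 -> expR (beta * W x) *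
     ((1 - delta) / 2 * (1 + b * expR (c * j.+2%:R)) +
      (1 + delta) / 2 * (1 + b * expR (c * j%:R))) <=
      expR r * (1 + b * expR (c * j.+1%:R)).
    move=> xj; set e := expR (c * j.+1%:R).
    have E1 : expR (c * j.+2%:R) = e * ((1 + delta) * cosh c).
      rewrite -(expR_drift delta01 cE) -expRD; congr expR.
      by rewrite -[j.+2%:R]natr1; ring.
    have E2 : expR (c * j%:R) = e * ((1 - delta) * cosh c).
      rewrite -(expRN_drift delta01 cE) -expRD; congr expR.
      by rewrite -[j.+1%:R]natr1; ring.
    have CV : (1 - delta) * (1 + delta) * cosh c = (cosh c)^-1.
      apply: (mulIf (x := cosh c)); first by rewrite gt_eqF.
      by rewrite mulVf ?gt_eqF// -[RHS](cosh_drift delta01 cE); ring.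
    have -> : (1 - delta) / 2 * (1 + b * expR (c * j.+2%:R)) +
      (1 + delta) / 2 * (1 + b * expR (c * j%:R)) = 1 + b * e / cosh c.
      by rewrite -CV E1 E2; field.
    have e0 : 0 < e := expR_gt0 _.
    have be : 0 < b * e by rewrite mulr_gt0.
    have [jm|mj] := leqP j.+1 m.
      apply: ler_pM; rewrite ?expR_ge0//.
      - by rewrite addr_ge0// divr_ge0// ltW.
      - apply: le_trans reta; rewrite ler_expR.
        have : beta * W x <= beta * h by rewrite ler_wpM2l// Wh// xj.
        lra.
      - by rewrite lerD2l ler_pdivrMr// ler_peMr ?(ltW be)// (cosh_ge1 delta01 cE).
    apply: (@le_trans _ _ (expR beta * (1 + b * e / cosh c))).
      rewrite ler_wpM2r// ?ler_expR ?ler_piMr//.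
      by rewrite addr_ge0// divr_ge0// ltW.
    have -> : expR r * (1 + b * e) = expR beta * (expR eta * (1 + b * e) / cosh c).
      by rewrite rE expRD; ring.
    rewrite ler_pM2l ?expR_gt0// ler_pdivlMr// mulrDl mul1r divfK ?gt_eqF//.
    have : 1 + c * j.+1%:R <= e by exact: expR_ge1Dx.
    have : c * m%:R <= c * j.+1%:R by rewrite ler_pM2l// ler_nat ltnW.
    move: (c * m%:R) (c * j.+1%:R) mge => u v mge uv ve.
    have : (expR eta - 1) * b * u <= (expR eta - 1) * b * e.
      by rewrite ler_pM2l ?mulr_gt0//; lra.
    by move: mge be e1; set E := expR eta; nra.
  have inside (A B : R) : 0 < A -> (absz (x - y)%R <= m)%N ->
      A <= expR (eta / 2) * B -> expR (beta * W x) * A <= expR r * B.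
    move=> A0 xm AB; apply: (@le_trans _ _ (expR (eta / 2) * (expR (eta / 2) * B))).
      apply: ler_pM; rewrite ?expR_ge0 ?(ltW A0)// ler_expR (le_trans _ bh)//.
      by rewrite ler_wpM2l// Wh.
    have B0 : 0 < B.
      by rewrite -(pmulr_rgt0 _ (expR_gt0 (eta / 2))) (lt_le_trans A0).
    by rewrite mulrA -expRD ler_pM2r// ler_expR /eta; move: betac rgt; lra.
  case: radialP far inside => [xy|j xy|j xy] far inside.
  - rewrite xy eqxx -mulrDl (_ : 2^-1 + 2^-1 = 1 :> R); last by field.
    rewrite mul1r mulr1 mulr0 expR0 mulr1 -xy.
    apply: inside => //; first by rewrite addr_gt0// mulr_gt0// expR_gt0.
    have : 0 < expR (eta / 2) * b by rewrite mulr_gt0 ?expR_gt0.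
    by rewrite bE; lra.
  - rewrite gt_eqF// xy /=; exact: far.
  - rewrite lt_eqF// ltNge (ltW xy) /= addrC; exact: far.
have A0 : 0 <= expR (th * y%:~R) / b by rewrite divr_ge0 ?expR_ge0 ?ltW.
apply: (le_trans (walk_exp_le (g := g) (A := expR (th * y%:~R) / b) _ _ (fun=> sup) _ A0)).
- by rewrite expR_ge0.
- by move=> i x bb; exact: (kernel_ok_ge0 (@seek_policy_ok y n)).
- move=> x _; rewrite /g -[leRHS]mulrA mulrDr mulr1 mulrA mulVf ?gt_eqF// mul1r.
  rewrite mulrDr -expRD; apply: (@le_trans _ _ (expR (th * y%:~R +
      c * (absz (x - y)%R)%:R))); last by rewrite lerDr mulr_ge0 ?expR_ge0 ?invr_ge0 ?ltW.
  rewrite ler_expR; have := ler_norm (th * x%:~R - th * y%:~R); rewrite th_dist.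
  have : `|th| * (absz (x - y)%R)%:R <= c * (absz (x - y)%R)%:R by rewrite ler_wpM2r.
  lra.
have gX : g X <= (1 + b) * expR (c * (absz (X - y)%R)%:R).
  rewrite mulrDl mul1r lerD2r -expR0 ler_expR mulr_ge0// ltW//.
have bb0 : 0 < (1 + b) / b by rewrite divr_gt0// addr_gt0.
have -> : expR (th * X%:~R + (`|th| + c) * (absz (X - y)%R)%:R + D + n%:R * r)
  = expR (th * X%:~R + `|th| * (absz (X - y)%R)%:R) / b * expR r ^+ n *
    ((1 + b) * expR (c * (absz (X - y)%R)%:R)).
  rewrite -expRM_natl; set t := `|_|%:R.
  have -> : th * X%:~R + (`|th| + c) * t + D + n%:R * r =
    th * X%:~R + `|th| * t + n%:R * r + c * t + D by ring.
  by rewrite 3!expRD /D lnK//; ring.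
apply: ler_pM => //.
- by rewrite mulr_ge0 ?exprn_ge0 ?expR_ge0.
- by rewrite /g addr_ge0// mulr_ge0 ?expR_ge0 ?ltW.
- rewrite ler_pM2r ?exprn_gt0 ?expR_gt0// ler_pM2r ?invr_gt0// ler_expR.
  by have := ler_norm (th * y%:~R - th * X%:~R); rewrite distrC th_dist; lra.
Qed.

End SeekUpperBound.

(** * Exponential rates *)

Section Rates.
Variable R : realType.
Implicit Types (delta beta th H e C : R) (W : int -> R).

Definition recurrent (E : int -> Prop) := forall e, 0 < e -> exists K : R,
  forall X : int, exists y : int, E y /\ `|(y - X)%:~R| <= e * `|X%:~R| + K :> R.

Definition lower_rate delta beta th W H := forall e C, 0 < e -> 0 <= C ->
  exists N : nat, forall n (X : int), (N <= n)%N -> `|X%:~R| <= C * n%:R ->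
  forall p : 'I_n -> int -> bool -> R, kernel_ok delta p ->
  expR (th * X%:~R + n%:R * (H - e)) <=
    walk_exp beta W (fun x => expR (th * x%:~R)) p X.

(** The policy may depend on [n] and [X], as the target of steering does. The parameter [policies]
    records who realises the bound: with a single policy, the rate also evaluates the simple
    walk. *)
Definition upper_rate_at (policies : set (int -> bool -> R)) beta th W H :=
  forall e C, 0 < e -> 0 <= C ->
  exists N : nat, forall n (X : int), (N <= n)%N -> `|X%:~R| <= C * n%:R ->
  exists2 q : int -> bool -> R, policies q &
  walk_exp beta W (fun x => expR (th * x%:~R)) (fun _ : 'I_n => q) X <=
    expR (th * X%:~R + n%:R * (H + e)).

Lemma linear_eventually_ge e (M : R) : 0 < e ->
  exists N : nat, forall n, (N <= n)%N -> M <= e * n%:R.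
Proof.
move=> e0; exists (Num.truncn (M / e)).+1 => n Nn.
rewrite mulrC -ler_pdivrMr// (le_trans (ltW (truncnS_gt _)))// ler_nat//.
Qed.

Lemma recurrent_cost e C (kappa D : R) (E : int -> Prop) :
  recurrent E -> 0 < e -> 0 <= C -> 0 <= kappa ->
  exists N : nat, forall n (X : int), (N <= n)%N -> `|X%:~R| <= C * n%:R ->
  exists y : int, E y /\ kappa * (absz (X - y)%R)%:R + D <= e * n%:R.
Proof.
move=> rE e0 C0 k0; pose e' := e / (2 * (kappa * C + 1)).
have kC : 0 <= kappa * C by rewrite mulr_ge0.
have p0 : 0 < 2 * (kappa * C + 1) by lra.
have e'0 : 0 < e' by rewrite divr_gt0.
have [K HK] := rE _ e'0.
have e2 : 0 < e / 2 by rewrite divr_gt0.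
have [N HN] := linear_eventually_ge (kappa * K + D) e2.
exists N => n X /HN Nn XC; have [y [Ey yX]] := HK X; exists y; split => //.
have -> : (absz (X - y)%R)%:R = `|(y - X)%:~R| :> R.
  by rewrite -intr_norm distrC.
have n0 : 0 <= n%:R :> R by [].
have h1 : kappa * `|(y - X)%:~R| <= kappa * (e' * (C * n%:R) + K).
  rewrite ler_wpM2l// (le_trans yX)// lerD2r ler_pM2l//.
have h2 : kappa * (e' * (C * n%:R)) <= e / 2 * n%:R.
  have -> : kappa * (e' * (C * n%:R)) = (kappa * C * e') * n%:R by ring.
  rewrite ler_wpM2r// /e' mulrA ler_pdivrMr//.
  have -> : e / 2 * (2 * (kappa * C + 1)) = e * (kappa * C) + e by field.
  by rewrite mulrC lerDl ltW.
rewrite mulrDr in h1; move: (n%:R : R) Nn h1 h2 => x Nn h1 h2.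
lra.
Qed.

(** * Rates from long intervals of extreme potential *)

Section Bulk.
Variables (delta c beta th : R) (W : int -> R).
Hypothesis delta01 : 0 < delta < 1.
Hypothesis cE : c = 2^-1 * ln ((1 + delta) / (1 - delta)).
Hypothesis beta0 : 0 <= beta.
Hypothesis W01 : forall k, 0 <= W k <= 1.

Lemma lower_rate_bulk :
  (forall h (m : nat), 0 < h < 1 -> recurrent (fun y =>
     forall k : int, (absz (k - y)%R <= m)%N -> h <= W k)) ->
  lower_rate delta beta th W (beta - ln (cosh c)).
Proof.
move=> rec e C e0 C0; set H := beta - _.
have rH : H - e / 2 < H by rewrite gtrBl divr_gt0.
have [h [m [kappa [D [h01 m0 k0 HS]]]]] := stay_lower_bound delta01 cE th beta0 rH.
have e2 : 0 < e / 2 by rewrite divr_gt0.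
have [N HN] := recurrent_cost D (rec h m h01) e2 C0 k0.
exists N => n X Nn XC p pk; have [y [Ey yX]] := HN n X Nn XC.
apply: le_trans (HS W y _ Ey n p X pk); last by move=> k; have /andP[] := W01 k.
rewrite ler_expR -!addrA lerD2l; move: yX; move: (n%:R : R) => x.
by lra.
Qed.

Lemma upper_rate_bulk : ln (cosh c) <= beta -> `|th| <= c ->
  (forall h (m : nat), 0 < h < 1 -> recurrent (fun y =>
     forall k : int, (absz (k - y)%R <= m)%N -> W k <= h)) ->
  upper_rate_at (fun q => forall n, kernel_ok delta (fun _ : 'I_n => q))
    beta th W (beta - ln (cosh c)).
Proof.
move=> betac thc rec e C e0 C0; set H := beta - _.
have rH : H < H + e / 2 by rewrite ltrDl divr_gt0.
have [h [m [kappa [D [h01 m0 k0 HS]]]]] :=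
  seek_upper_bound delta01 cE beta0 betac thc rH.
have e2 : 0 < e / 2 by rewrite divr_gt0.
have [N HN] := recurrent_cost D (rec h m h01) e2 C0 k0.
exists N => n X Nn XC; have [y [Ey yX]] := HN n X Nn XC.
exists (seek_policy delta y); first by move=> k; exact: seek_policy_ok.
apply: (le_trans (HS W y _ Ey n X)); first by move=> k; have /andP[] := W01 k.
rewrite ler_expR -!addrA lerD2l; move: yX; move: (n%:R : R) => x.
by lra.
Qed.

End Bulk.

(** * Rates from solutions of the recursion and the constant drift *)

Section Tilt.
Variables (delta c beta lam s G : R) (W F : int -> R).
Hypothesis delta01 : 0 < delta < 1.
Hypothesis cE : c = 2^-1 * ln ((1 + delta) / (1 - delta)).
Hypothesis s1 : s = 1 \/ s = -1.

(** The constant drift [- s delta], opposed to the direction [s], in exponential form so that the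
    change of measure is visible. *)
Definition tilt_policy (x : int) (b : bool) : R :=
  expR (- (s * c * (step b)%:~R)) / (2 * cosh c).

Let tiltE :
  (tilt_policy 0 true = (1 - s * delta) / 2) * (tilt_policy 0 false = (1 + s * delta) / 2).
Proof.
have C0 := cosh_gt0 c; have Cn0 : cosh c != 0 by rewrite gt_eqF.
rewrite /tilt_policy /step mulrN1 mulr1; case: s1 => ->.
  rewrite !mul1r opprK (expR_drift delta01 cE) (expRN_drift delta01 cE).
  by split; field.
rewrite !mulN1r !opprK (expR_drift delta01 cE) (expRN_drift delta01 cE).
by split; field.
Qed.

Lemma tilt_policy_ok n : kernel_ok delta (fun _ : 'I_n => tilt_policy).
Proof.
move=> _ y; rewrite -[tilt_policy y]/(tilt_policy 0).
have /andP[d0 d1] := delta01; have [t1 t2] := tiltE.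
case: s1 t1 t2 => -> t1 t2; split => /=; rewrite ?t1 ?t2.
- by case; rewrite ?t1 ?t2; apply/andP; split; lra.
- lra.
- by apply/ler_normlP; split; lra.
- by case; rewrite ?t1 ?t2; apply/andP; split; lra.
- lra.
- by apply/ler_normlP; split; lra.
Qed.

Lemma tilt_policy_avg (f : int -> R) x :
  tilt_policy x true * (expR (s * c * (x + 1)%:~R) * f (x + 1)) +
  tilt_policy x false * (expR (s * c * (x - 1)%:~R) * f (x - 1)) =
  expR (s * c * x%:~R) * (2^-1 * f (x + 1) + 2^-1 * f (x - 1)) / cosh c.
Proof.
have C0 := cosh_gt0 c; have Cn0 : cosh c != 0 by rewrite gt_eqF.
have e1 : expR (s * c * (x + 1)%:~R) * expR (- (s * c * 1%:~R)) = expR (s * c * x%:~R).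
  by rewrite -expRD; congr expR; rewrite intrD; ring.
have e2 : expR (s * c * (x - 1)%:~R) * expR (- (s * c * (-1)%:~R)) = expR (s * c * x%:~R).
  by rewrite -expRD; congr expR; rewrite intrD; ring.
rewrite /tilt_policy /step mulrDr -{1}e1 -e2; by field.
Qed.

(** An exact change of measure, iterating [tilt_policy_avg]; it links the free energy of the simple
    walk to the controlled walk. *)
Lemma walk_exp_tilt (f : int -> R) n x :
  walk_exp beta W f (fun (_ : 'I_n) _ _ => 2^-1) x * expR (s * c * x%:~R) =
  cosh c ^+ n *
  walk_exp beta W (fun y => expR (s * c * y%:~R) * f y) (fun _ : 'I_n => tilt_policy) x.
Proof.
have C0 := cosh_gt0 c; have Cn0 : cosh c != 0 by rewrite gt_eqF.
elim: n x => [|n IH] x; first by rewrite !walk_exp0 expr0 mul1r mulrC.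
rewrite !walk_expS exprSr.
pose w y := walk_exp beta W f (fun (_ : 'I_n) _ _ => 2^-1) y.
pose v y := walk_exp beta W (fun y => expR (s * c * y%:~R) * f y)
  (fun _ : 'I_n => tilt_policy) y.
have vE y : cosh c ^+ n * v y = expR (s * c * y%:~R) * w y by rewrite -IH mulrC.
rewrite -!/(w _) -!/(v _).
have -> : cosh c ^+ n * cosh c * (expR (beta * W x) *
    (tilt_policy x true * v (x + 1) + tilt_policy x false * v (x - 1))) =
  cosh c * expR (beta * W x) * (tilt_policy x true * (cosh c ^+ n * v (x + 1)) +
    tilt_policy x false * (cosh c ^+ n * v (x - 1))) by ring.
by rewrite !vE tilt_policy_avg; field.
Qed.

Hypothesis F0 : forall k, 0 < F k.
Hypothesis FE : forall k,
  F (k + 1) + F (k - 1) = 2 * expR (lam - beta * W k) * F k.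
Hypothesis Fasymp : asymp_linear (fun k => ln (F k)) (s * G).

(** [E] bounds the error of [ln F] at every site within reach, all of which satisfy
    [|y| <= (C + 1) n]. It is paid at the start and at the end of the walk, and [ln 2] is reserved
    for the summand 1 in the upper bound. *)
Lemma tilt_error e C : 0 < e -> 0 <= C -> exists N : nat, forall n,
  (N <= n)%N -> exists E : R, [/\ 0 <= E, 2 * E + ln 2 <= e * n%:R &
    forall X y : int, `|X%:~R| <= C * n%:R -> `|y - X| <= n%:Z ->
    expR (s * G * y%:~R - E) <= F y <= expR (s * G * y%:~R + E)].
Proof.
move=> e0 C0; pose e' := e / (4 * (C + 1)).
have p0 : 0 < 4 * (C + 1) by lra.
have e'0 : 0 < e' by rewrite divr_gt0.
have [K HK] := Fasymp e'0.
have K0 : 0 <= K by have := HK 0; rewrite normr0 mulr0 add0r; exact: le_trans.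
have e2 : 0 < e / 2 by rewrite divr_gt0.
have [N HN] := linear_eventually_ge (2 * K + ln 2) e2.
exists N => n /HN Nn; exists (e' * ((C + 1) * n%:R) + K).
have n0 : 0 <= n%:R :> R by [].
have -> : e' * ((C + 1) * n%:R) = e / 4 * n%:R.
  by rewrite /e'; field; lra.
split.
- by rewrite addr_ge0// mulr_ge0// divr_ge0// ltW.
- by move: Nn; move: (n%:R : R) => x; lra.
move=> X y XC yX.
have yn : `|y%:~R| <= (C + 1) * n%:R :> R.
  have -> : y%:~R = X%:~R + (y - X)%:~R :> R by rewrite -intrD addrCA subrr addr0.
  rewrite (le_trans (ler_normD _ _))// mulrDl mul1r lerD//.
  by rewrite -intr_norm -[n%:R]/(n%:~R) ler_int.
have : `|ln (F y) - y%:~R * (s * G)| <= e / 4 * n%:R + K.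
  rewrite (le_trans (HK y))// lerD2r.
  have -> : e / 4 * n%:R = e' * ((C + 1) * n%:R) by rewrite /e'; field; lra.
  by rewrite ler_pM2l.
rewrite mulrC => /ler_normlP[h1 h2].
by rewrite -[F y]lnK ?posrE// !ler_expR; apply/andP; split; lra.
Qed.

(** With [u = s (y - X)] and [0 <= th' <= G], the relative terminal weight [e^(th' u)] is at most
    [1 + e^(G u)]. Before tilting, [F] has the factor [e^lam] exactly and 1 at most that factor, as
    [beta W <= lam]. Slopes [th' < G] are allowed in order to treat those that no exponent
    attains. *)
Lemma upper_rate_tilt th' : (forall k, beta * W k <= lam) -> 0 <= th' <= G ->
  upper_rate_at [set tilt_policy] beta (s * (c + th')) W (lam - ln (cosh c)).
Proof.
move=> Wl /andP[t0 tG] e C e0 C0; have [N HN] := tilt_error e0 C0.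
have Ch0 := cosh_gt0 c.
exists N => n X Nn XC; have [E [E0 En HE]] := HN n Nn; exists tilt_policy => //.
pose g x := expR (s * c * x%:~R) * (1 + expR (- (s * G * X%:~R)) * F x).
pose A := expR E * expR (s * th' * X%:~R).
have A0 : 0 <= A by rewrite mulr_ge0 ?expR_ge0.
have p0 := kernel_ok_ge0 (@tilt_policy_ok n).
have rE : expR (lam - ln (cosh c)) = expR lam / cosh c.
  by rewrite expRD expRN lnK ?posrE.
have sup x : expR (beta * W x) * (tilt_policy x true * g (x + 1) +
    tilt_policy x false * g (x - 1)) <= expR (lam - ln (cosh c)) * g x.
  rewrite /g (tilt_policy_avg (fun y => 1 + expR (- (s * G * X%:~R)) * F y)) rE.
  have wl : expR (beta * W x) <= expR lam by rewrite ler_expR.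
  have wE : expR (beta * W x) * expR (lam - beta * W x) = expR lam.
    by rewrite -expRD; congr expR; ring.
  set a := expR (- _); set b := expR (s * c * _).
  have -> : expR (beta * W x) *
      (b * (2^-1 * (1 + a * F (x + 1)) + 2^-1 * (1 + a * F (x - 1))) / cosh c) =
    b / cosh c * (expR (beta * W x) * (1 + 2^-1 * a * (F (x + 1) + F (x - 1)))).
    by field; rewrite gt_eqF.
  rewrite FE.
  have -> : expR (beta * W x) * (1 + 2^-1 * a * (2 * expR (lam - beta * W x) * F x)) =
     expR (beta * W x) + a * F x * expR lam by rewrite -wE; field.
  have -> : expR lam / cosh c * (b * (1 + a * F x)) = b / cosh c * (expR lam + a * F x * expR lam).
    by ring.
  by rewrite ler_pM2l ?lerD2r// divr_gt0 ?expR_gt0.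
apply: (le_trans (walk_exp_le (g := g) (A := A) (expR_ge0 _) p0 (fun=> sup) _ A0)).
  move=> y yX; have /andP[h1 _] := HE X y XC yX.
  have -> : expR (s * (c + th') * y%:~R) = expR (s * c * y%:~R) *
      (expR (s * th' * X%:~R) * expR (th' * (s * (y%:~R - X%:~R)))).
    by rewrite -!expRD; congr expR; ring.
  rewrite /A /g; set u := s * (y%:~R - X%:~R).
  have -> : expR E * expR (s * th' * X%:~R) * (expR (s * c * y%:~R) *
     (1 + expR (- (s * G * X%:~R)) * F y)) = expR (s * c * y%:~R) *
     (expR (s * th' * X%:~R) * (expR E + expR E * expR (- (s * G * X%:~R)) * F y)) by ring.
  rewrite !ler_pM2l ?expR_gt0//.
  have h2 : expR (G * u) <= expR E * expR (- (s * G * X%:~R)) * F y.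
    apply: le_trans (ler_wpM2l _ h1); last by rewrite mulr_ge0 ?expR_ge0.
    by rewrite -!expRD ler_expR /u; lra.
  have E1 : 1 <= expR E by rewrite -expR0 ler_expR.
  have [u0|u0] := leP 0 u.
    apply: (@le_trans _ _ (expR (G * u))); first by rewrite ler_expR ler_wpM2r.
    by rewrite (le_trans h2)// lerDr expR_ge0.
  apply: (@le_trans _ _ 1).
    by rewrite -[leRHS]expR0 ler_expR mulr_ge0_le0// ltW.
  by rewrite (le_trans E1)// lerDl mulr_ge0 ?mulr_ge0 ?expR_ge0 ?(ltW (F0 _)).
have X0 : `|X - X| <= n%:Z by rewrite subrr normr0.
have /andP[_ h1] := HE X X XC X0.
have gX : g X <= expR (s * c * X%:~R) * (expR (ln 2) * expR E).
  rewrite ler_pM2l ?expR_gt0// lnK ?posrE// mulrDl mul1r lerD//.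
    by rewrite -expR0 ler_expR.
  rewrite -ler_pdivlMl ?expR_gt0// -expRN opprK -expRD; exact: h1.
apply: (le_trans (ler_wpM2l _ gX)); first by rewrite mulr_ge0 ?exprn_ge0 ?expR_ge0.
rewrite /A -expRM_natl -!expRD ler_expR; move: En; move: (n%:R : R) => x.
lra.
Qed.

Lemma lower_rate_tilt : (forall k, 0 <= s * (F (k + 1) - F (k - 1))) ->
  lower_rate delta beta (s * (c + G)) W (lam - ln (cosh c)).
Proof.
move=> Fmono e C e0 C0; have [N HN] := tilt_error e0 C0.
have Ch0 := cosh_gt0 c; have c0 := drift_gt0 delta01 cE.
exists N => n X Nn XC p pk; have [E [E0 En HE]] := HN n Nn.
pose g x := expR (s * c * x%:~R) * F x.
have p0 := kernel_ok_ge0 pk.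
have rE : expR (lam - ln (cosh c)) = expR lam / cosh c.
  by rewrite expRD expRN lnK ?posrE.
have gmono x : 0 <= s * (g (x + 1) - g (x - 1)).
  have := Fmono x; have Fp := F0 (x + 1); have Fm := F0 (x - 1).
  rewrite /g !intrD; case: s1 => ->.
    rewrite !mul1r !subr_ge0 => Fx; apply: ler_pM; rewrite ?expR_ge0 ?(ltW Fm)//.
    by rewrite ler_expR ler_pM2l//; lra.
  rewrite !mulN1r !oppr_ge0 !subr_le0 => Fx.
  apply: ler_pM; rewrite ?expR_ge0 ?(ltW Fp)// ler_expR.
  by rewrite ler_nM2l ?oppr_lt0//; lra.
have sub i x : expR (lam - ln (cosh c)) * g x <=
    expR (beta * W x) * (p i x true * g (x + 1) + p i x false * g (x - 1)).
  have [-> q1 q2] := kernel_ok_itv i x pk.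
  have -> : expR (lam - ln (cosh c)) * g x = expR (beta * W x) *
      (tilt_policy x true * g (x + 1) + tilt_policy x false * g (x - 1)).
    rewrite /g tilt_policy_avg -mulrDr FE rE.
    have -> : expR lam = expR (beta * W x) * expR (lam - beta * W x).
      by rewrite -expRD; congr expR; ring.
    by field; rewrite gt_eqF.
  rewrite ler_pM2l ?expR_gt0// -[tilt_policy x]/(tilt_policy 0) !tiltE.
  have := gmono x; case: s1 => ->.
    rewrite !mul1r => gx.
    have : 0 <= (p i x true - (1 - delta) / 2) * (g (x + 1) - g (x - 1)).
      by rewrite mulr_ge0//; lra.
    lra.
  rewrite !mulN1r => gx.
  have : 0 <= ((1 + delta) / 2 - p i x true) * - (g (x + 1) - g (x - 1)).
    by rewrite mulr_ge0//; lra.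
  lra.
have X0 : `|X - X| <= n%:Z by rewrite subrr normr0.
have /andP[h1 _] := HE X X XC X0.
apply: le_trans (walk_exp_ge (g := g) (A := expR (- E)) (expR_ge0 _) p0 sub _ (expR_ge0 _)).
  apply: (@le_trans _ _ (expR (- E) * expR (lam - ln (cosh c)) ^+ n *
      (expR (s * c * X%:~R) * expR (s * G * X%:~R - E)))); last first.
    by rewrite ler_wpM2l ?mulr_ge0 ?exprn_ge0 ?expR_ge0// ler_wpM2l ?expR_ge0.
  rewrite -expRM_natl -!expRD ler_expR; have : 0 <= ln 2 :> R by rewrite ln_ge0// ler1n.
  by move: En; move: (n%:R : R) => x; lra.
move=> y yX; have /andP[_ h2] := HE X y XC yX.
rewrite /g mulrCA (_ : expR (s * (c + G) * y%:~R) =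
  expR (s * c * y%:~R) * expR (s * G * y%:~R)); last first.
  by rewrite -expRD; congr expR; ring.
by rewrite ler_pM2l ?expR_gt0// expRN mulrC ler_pdivrMr ?expR_gt0// -expRD.
Qed.

End Tilt.
End Rates.

(** * Almost sure rates *)

(** Growth to the right for [s = 1] and to the left for [s = -1], so that both signs of [theta]
    share one argument. *)
Definition oriented_solution (R : realType) (s beta lam : R) (W : int -> R)
    (G : R) (F : int -> R) :=
  [/\ forall k, 0 < F k,
      forall k, F (k + 1) + F (k - 1) = 2 * expR (lam - beta * W k) * F k,
      asymp_linear (fun k => ln (F k)) (s * G) &
      forall k, 0 <= s * (F (k + 1) - F (k - 1))].

Lemma growth_solution_mono (R : realType) (beta lam : R) (W : int -> R) (G : R)
    (F : int -> R) (k : int) : beta < lam -> growth_solution beta lam W G F ->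
  F k <= F (k + 1).
Proof.
move=> bl [F0 _ Fr _]; rewrite (le_trans (Fr k))// ler_piMl//; first exact/ltW.
by rewrite -[leRHS]expR0 ler_expR oppr_le0 subr_ge0 ltW.
Qed.

Lemma growth_oriented (R : realType) (beta lam : R) (W : int -> R) (G : R)
    (F : int -> R) : beta < lam -> growth_solution beta lam W G F ->
  oriented_solution 1 beta lam W G F.
Proof.
move=> bl gF; have [F0 FE _ Fa] := gF; split=> // [|k]; first by rewrite mul1r.
rewrite mul1r subr_ge0 (le_trans (growth_solution_mono (k - 1) bl gF))// subrK.
exact: growth_solution_mono gF.
Qed.

Lemma growth_oriented_opp (R : realType) (beta lam : R) (W : int -> R) (G : R)
    (F : int -> R) : beta < lam ->
  growth_solution beta lam (fun k => W (- k)) G F ->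
  oriented_solution (-1) beta lam W G (fun k => F (- k)).
Proof.
move=> bl gF; have [F0 FE _ Fa] := gF; split=> // [k|e e0|k].
- by rewrite opprD opprB addrC -[1 - k]addrC FE opprK.
- have [K HK] := Fa e e0; exists K => k; have := HK (- k).
  by rewrite mulrNz normrN mulN1r mulNr mulrN.
- rewrite (_ : - (k + 1) = - k - 1); last by lia.
  rewrite (_ : - (k - 1) = - k + 1); last by lia.
  rewrite mulN1r opprB subr_ge0.
  apply: (le_trans (growth_solution_mono (- k - 1) bl gF)); rewrite subrK.
  exact: growth_solution_mono gF.
Qed.

Lemma upper_rate_at_lim (R : realType) (policies : set (int -> bool -> R))
    (beta th : R) (W : int -> R) (H : R) :
  (forall k : nat, upper_rate_at policies beta th W (H + k.+1%:R^-1)) ->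
  upper_rate_at policies beta th W H.
Proof.
move=> Hk e C e0 C0.
have e2 : 0 < e / 2 by rewrite divr_gt0.
have [N0 HN0] := linear_eventually_ge 1 e2.
have kn : (N0 <= N0.+1)%N by [].
have ke : (N0.+1)%:R^-1 <= e / 2.
  by rewrite -div1r ler_pdivrMr ?ltr0n// HN0.
have [N HN] := Hk N0 _ _ e2 C0; exists N => n X nN XC.
have [q qp qX] := HN n X nN XC; exists q => //; apply: le_trans qX _.
rewrite ler_expR lerD2l ler_wpM2l// -addrA lerD2l -lerBrDr (le_trans ke)//.
by rewrite le_eqVlt; apply/orP; left; apply/eqP; field.
Qed.

Section AlmostSure.
Context (R : realType) (d : measure_display) (Omega : measurableType d).
Variables (P : probability Omega R) (T Tinv : Omega -> Omega).
Hypotheses (TK : cancel T Tinv) (TinvK : cancel Tinv T).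
Hypotheses (T_mp : measure_preserving P T) (Tinv_mp : measure_preserving P Tinv).
Hypotheses (T_erg : ergodic P T) (Tinv_erg : ergodic P Tinv).
Variable V : Omega -> R.
Hypothesis mV : measurable_fun [set: Omega] V.
Hypothesis V01 : forall w, 0 <= V w <= 1.

Let env w (k : int) := V (iterT T Tinv k w).

Lemma recurrent_ae (A : set Omega) : measurable A -> (0 < P A)%E ->
  {ae P, forall w, recurrent R (fun y => A (iterT T Tinv y w))}.
Proof.
move=> mA PA.
have m1 : measurable_fun [set: Omega] (\1_A : Omega -> R).
  exact: measurable_indic.
have b1 w : `|\1_A w| <= 1 :> R.
  by rewrite indicE normr_nat; case: (_ \in _).
have := birkhoff_int TK TinvK T_mp Tinv_mp T_erg Tinv_erg m1 b1.
have m0 : 0 < \int[P]_w (\1_A w : R).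
  rewrite /Rintegral integral_indic// setIT fine_gt0// PA /=.
  by rewrite (le_lt_trans (probability_le1 P mA))// ltry.
apply: filterS => w Hw e e0; apply: (asymp_linear_gap m0 Hw) => // k nA.
by rewrite isum_succ indicE memNset// addr0.
Qed.

Lemma iterT_addn (y : int) (j : nat) w :
  iterT T Tinv j%:Z (iterT T Tinv y w) = iterT T Tinv (y + j%:Z) w.
Proof.
elim: j => [|j IH]; first by rewrite addr0.
by rewrite -addn1 PoszD addrA !iterT_succ// IH.
Qed.

Lemma recurrent_window (B : set R) : measurable B ->
  (forall l : nat, (0 < l)%N ->
     (0 < P [set w | forall y : nat, (y <= l)%N -> B (V (iterT T Tinv y w))])%E) ->
  {ae P, forall w, forall m : nat, recurrent R (fun y =>
     forall k : int, (absz (k - y)%R <= m)%N -> B (env w k))}.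
Proof.
move=> mB PB; apply: ae_foralln => m.
(* The hypothesis looks forward only, so an interval of radius [m] about [y + m] is read off from a
   block starting at [y]. The extra 1 keeps the length positive for [m = 0]. *)
pose A := [set w | forall y : nat, (y <= m.*2.+1)%N -> B (V (iterT T Tinv y w))].
have [mT _] := T_mp.
have mA : measurable A.
  rewrite (_ : A = \bigcap_y (if (y <= m.*2.+1)%N then
      (V \o iter y T) @^-1` B else setT)).
    apply: bigcapT_measurable => y; case: ifP => // _.
    rewrite -[X in measurable X]setTI; apply: measurableT_comp => //.
    by elim: y => [|y IH]; [exact: measurable_id|exact: measurableT_comp].
  apply/seteqP; split => w wA y; first by move=> _; case: ifP => // /wA.
  by move=> yl; have := wA y I; rewrite yl.
apply: filterS (recurrent_ae mA (PB _ _)) => // w rA e e0.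
have [K HK] := rA e e0; exists (K + m%:R) => X; have [y [Ay yX]] := HK X.
exists (y + m%:Z); split.
  move=> k km; have := Ay (absz (k - y)%R); rewrite iterT_addn.
  rewrite /env (_ : y + _ = k); last by lia.
  by apply; lia.
rewrite addrAC intrD (le_trans (ler_normD _ _))// addrA lerD//.
by rewrite -[m%:~R]/(m%:R) normr_nat.
Qed.

Variable beta : R.
Hypothesis beta0 : 0 <= beta.

(** The leftward solution is the growing one for the inverse transformation, whose environment is
    the mirror image. Its exponent is a priori that built from [T]; the Wronskian identifies it with
    the one built from [Tinv]. *)
Lemma oriented_solution_ae (lam : R) : beta < lam ->
  {ae P, forall w, forall s : R, s = 1 \/ s = -1 ->
    exists F, oriented_solution s beta lam (env w) (lyapunov P V beta Tinv lam) F}.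
Proof.
move=> bl; have H1 := growth_solution_ae mV V01 beta0 TK TinvK T_mp Tinv_mp T_erg Tinv_erg bl.
have H2 := growth_solution_ae mV V01 beta0 TinvK TK Tinv_mp T_mp Tinv_erg T_erg bl.
apply: filterS2 H1 H2 => w [F gF] [F' gF'] s.
have W' : (fun k => V (iterT Tinv T k w)) = (fun k => env w (- k)).
  by apply/funext => k; rewrite /env iterT_opp.
rewrite W' in gF'; have GG := growth_exponent_unique bl gF gF'.
case=> ->; first by exists F; exact: growth_oriented.
by exists (fun k => F' (- k)); rewrite GG; exact: growth_oriented_opp.
Qed.

Variables (delta c : R).
Hypothesis delta01 : 0 < delta < 1.
Hypothesis cE : c = 2^-1 * ln ((1 + delta) / (1 - delta)).

Lemma rates_tilt_ae (th : R) : 0 <= th ->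
  {ae P, forall w, forall h (m : nat), 0 < h < 1 -> recurrent R (fun y =>
     forall k : int, (absz (k - y)%R <= m)%N -> h <= env w k)} ->
  exists Lam : R, {ae P, forall w, forall s : R, s = 1 \/ s = -1 ->
    lower_rate delta beta (s * (c + th)) (env w) (Lam - ln (cosh c)) /\
    upper_rate_at [set tilt_policy c s] beta (s * (c + th)) (env w)
      (Lam - ln (cosh c))}.
Proof.
move=> th0 rec; have [mTinv _] := Tinv_mp.
have W01 w k : 0 <= env w k <= 1 by exact: V01.
have Wl w k lam : beta < lam -> beta * env w k <= lam.
  move=> bl; rewrite (le_trans _ (ltW bl))// ler_piMr//.
  by have /andP[] := W01 w k.
have [[lam bl Gl]|noG] := pselect (exists2 lam, beta < lam & lyapunov P V beta Tinv lam = th).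
  exists lam; apply: filterS (oriented_solution_ae bl) => w Hw s s1.
  have [F [F0 FE Fa Fm]] := Hw s s1; rewrite Gl in Fa; split.
    exact: (lower_rate_tilt delta01 cE s1 F0 FE Fa Fm).
  apply: (upper_rate_tilt delta01 cE s1 F0 FE Fa) => [k|]; first exact: Wl.
  by rewrite th0 lexx.
(* By the intermediate value argument, a slope that is not attained lies below all exponents. Slope
   0, the boundary [|theta| = c], always leads here because every exponent is at least
   [lam - beta > 0]. *)
have Gth lam : beta < lam -> th <= lyapunov P V beta Tinv lam.
  move=> bl; rewrite leNgt; apply/negP => /ltW Gl; apply: noG.
  exact: (lyapunov_surjective mV V01 beta0 mTinv bl Gl).
exists beta; have bk (k : nat) : beta < beta + k.+1%:R^-1.
  by rewrite ltrDl invr_gt0 ltr0n.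
have := ae_foralln (fun k => oriented_solution_ae (bk k)).
apply: filterS2 rec => w Hrec Hw s s1; split.
  exact: lower_rate_bulk.
apply: upper_rate_at_lim => k; have [F [F0 FE Fa _]] := Hw k s s1.
rewrite addrAC.
apply: (upper_rate_tilt delta01 cE s1 F0 FE Fa) => [j|]; first exact: Wl.
by rewrite th0 Gth.
Qed.

End AlmostSure.

(** * Scaling limit *)

Lemma affine_dist (R : realType) (t x eps a b H th : R) :
  t - eps <= a <= t -> x - eps <= b <= x ->
  `|t * H + th * x - (a * H + th * b)| <= eps * (`|H| + `|th|).
Proof.
move=> /andP[a1 a2] /andP[b1 b2].
have -> : t * H + th * x - (a * H + th * b) = (t - a) * H + (x - b) * th by ring.
rewrite (le_trans (ler_normD _ _))// !normrM mulrDr.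
by apply: lerD; rewrite ler_wpM2r//; apply/ler_normlP; split; lra.
Qed.

Lemma scaling_limit (R : realType) (U : nat -> int -> R) (th H : R) :
  (forall e C : R, 0 < e -> 0 <= C -> exists N : nat, forall n (X : int),
     (N <= n)%N -> `|X%:~R| <= C * n%:R ->
     `|U n X - (th * X%:~R + n%:R * H)| <= e * n%:R) ->
  forall t x : R, 0 < t ->
  eps * U (Num.truncn (eps^-1 * t)) (Num.floor (eps^-1 * x)) @[eps --> 0^'+] -->
    t * H + th * x.
Proof.
move=> HU t x t0; apply/cvgrPdist_le => e e0.
(* For small [eps] one has [eps n >= t / 2] and [eps |X| <= |x| + 1]; likewise [eps n <= t] explains
   [e1]. *)
pose C := 2 * (`|x| + 1) / t.
have C0 : 0 <= C by rewrite divr_ge0 ?(ltW t0)// mulr_ge0// addr_ge0.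
pose e1 := e / (2 * t); have e10 : 0 < e1 by rewrite divr_gt0// mulr_gt0.
have [N HN] := HU e1 C e10 C0.
have p1 : 0 < `|H| + `|th| + 1 by have := normr_ge0 H; have := normr_ge0 th; lra.
near=> eps.
have eps0 : 0 < eps by near: eps; exact: nbhs_right_gt.
have eps1 : eps <= 1 by near: eps; exact: nbhs_right_le.
have eps2 : eps <= t / 2 by near: eps; apply: nbhs_right_le; rewrite divr_gt0.
have eps3 : eps <= t / N.+1%:R by near: eps; apply: nbhs_right_le; rewrite divr_gt0.
have eps4 : eps <= e / (2 * (`|H| + `|th| + 1)).
  by near: eps; apply: nbhs_right_le; rewrite divr_gt0// mulr_gt0.
set n := Num.truncn _; set X := Num.floor _.
have /andP[n1 n2] : n%:R <= eps^-1 * t < n.+1%:R.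
  by apply: truncn_itv; rewrite mulr_ge0 ?invr_ge0 ?(ltW eps0) ?(ltW t0).
have /andP[X1 X2] := floor_itv (eps^-1 * x); rewrite -/X intrD in X1 X2.
have epsn0 : eps != 0 by rewrite gt_eqF.
have en1 : eps * n%:R <= t.
  by rewrite -[leRHS](mulVKf epsn0) ler_pM2l.
have en2 : t - eps <= eps * n%:R.
  have : eps * (eps^-1 * t) < eps * n.+1%:R by rewrite ltr_pM2l.
  by rewrite mulVKf// -natr1 mulrDr mulr1; lra.
have eX1 : eps * X%:~R <= x.
  by rewrite -[leRHS](mulVKf epsn0) ler_pM2l.
have eX2 : x - eps <= eps * X%:~R.
  have : eps * (eps^-1 * x) < eps * (X%:~R + 1%:~R) by rewrite ltr_pM2l.
  by rewrite mulVKf// mulrDr mulr1; lra.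
have nN : (N <= n)%N.
  rewrite -(ler_nat R) -(lerD2r 1) natr1 -(ler_pM2l eps0).
  rewrite mulrDr mulr1; apply: (@le_trans _ _ t); last lra.
  by rewrite -ler_pdivlMr.
have XC : `|X%:~R| <= C * n%:R :> R.
  rewrite -(ler_pM2l eps0) -{1}(gtr0_norm eps0) -normrM.
  have h1 : `|eps * X%:~R| <= `|x| + 1.
    have := ler_norm x; have := ler_norm (- x); rewrite normrN => *.
    by apply/ler_normlP; split; lra.
  apply: (le_trans h1); rewrite mulrCA.
  apply: (@le_trans _ _ (C * (t / 2))); last by rewrite ler_wpM2l//; lra.
  by rewrite /C le_eqVlt; apply/orP; left; apply/eqP; field; rewrite gt_eqF.
have := HN n X nN XC.
rewrite -(ler_pM2l eps0) -{1}(gtr0_norm eps0) -normrM mulrBr.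
have h2 : eps * (e1 * n%:R) <= e / 2.
  rewrite mulrCA; apply: (@le_trans _ _ (e1 * t)); first by rewrite ler_pM2l.
  by rewrite /e1 le_eqVlt; apply/orP; left; apply/eqP; field; rewrite gt_eqF.
have h3 : eps * (`|H| + `|th|) <= e / 2.
  apply: (@le_trans _ _ (eps * (`|H| + `|th| + 1))).
    by rewrite ler_pM2l// lerDl.
  move: eps4; rewrite ler_pdivlMr ?mulr_gt0// => h; lra.
have h4 : `|t * H + th * x - eps * (th * X%:~R + n%:R * H)| <= eps * (`|H| + `|th|).
  have -> : eps * (th * X%:~R + n%:R * H) = (eps * n%:R) * H + th * (eps * X%:~R).
    by ring.
  by apply: affine_dist; rewrite ?en1 ?en2 ?eX1 ?eX2.
move=> h5; rewrite -[_ - _](subrKA (eps * (th * X%:~R + n%:R * H))).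
rewrite (le_trans (ler_normD _ _))// (_ : e = e / 2 + e / 2); last by field.
apply: lerD; first exact: le_trans h4 h3.
by rewrite distrC (le_trans h5).
Unshelve. all: by end_near. Qed.

(** * From rates to the value function and the free energy *)

Section Value.
Context (R : realType) (d : measure_display) (Omega : measurableType d).
Variables (T Tinv : Omega -> Omega) (V : Omega -> R) (delta beta th : R) (w : Omega).

Let env (k : int) := V (iterT T Tinv k w).

Lemma path_expectation_exp_reward n (p : 'I_n -> int -> bool -> R) x :
  path_expectation p x (exp_reward T Tinv V beta th x w) =
  walk_exp beta env (fun y => expR (th * y%:~R)) p x.
Proof. by apply: eq_bigr => z _; rewrite /exp_reward expRD. Qed.

Lemma u_rate (policies : set (int -> bool -> R)) (H : R) :
  (forall q, policies q -> forall n, kernel_ok delta (fun _ : 'I_n => q)) ->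
  lower_rate delta beta th env H -> upper_rate_at policies beta th env H ->
  forall e C : R, 0 < e -> 0 <= C -> exists N : nat, forall n (X : int),
     (N <= n)%N -> `|X%:~R| <= C * n%:R ->
     `|u T Tinv V delta beta th n X w - (th * X%:~R + n%:R * H)| <= e * n%:R.
Proof.
move=> pol lr ur e C e0 C0; have [N1 H1] := lr e C e0 C0.
have [N2 H2] := ur e C e0 C0; exists (maxn N1 N2) => n X; rewrite geq_max.
move=> /andP[nN1 nN2] XC; have {}H1 := H1 n X nN1 XC.
have [q qp {}H2] := H2 n X nN2 XC; have qk := pol q qp n.
pose S := [set ln (path_expectation (fun i => pi i w) X
  (exp_reward T Tinv V beta th X w)) | pi in @admissible R d Omega n delta].
pose piq : policy R Omega n := fun _ _ y b => q y b.
have aq : @admissible R d Omega n delta piq.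
  by split => [i y b|i w' y]; [exact: measurable_cst|exact: (qk i y)].
(* The real infimum is meaningful only for a nonempty set that is bounded below; [Sq] and [lbS]
   provide this. *)
have Sq : S (ln (walk_exp beta env (fun y => expR (th * y%:~R)) (fun _ : 'I_n => q) X)).
  by exists piq => //; rewrite path_expectation_exp_reward.
have lbS : lbound S (th * X%:~R + n%:R * (H - e)).
  move=> _ [pi [_ pik] <-]; rewrite path_expectation_exp_reward.
  have h := H1 (fun i => pi i w) (fun i y => pik i w y).
  by rewrite -[leLHS]expRK ler_ln ?posrE ?expR_gt0// (lt_le_trans (expR_gt0 _) h).
have l1 : th * X%:~R + n%:R * (H - e) <= inf S.
  by apply: lb_le_inf => //; eexists; exact: Sq.
have l2 : inf S <= th * X%:~R + n%:R * (H + e).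
  apply: le_trans (ge_inf _ Sq) _; first by eexists; exact: lbS.
  rewrite -[leRHS]expRK ler_ln ?posrE ?expR_gt0//.
  exact: lt_le_trans (expR_gt0 _) (H1 _ qk).
rewrite /u -/S; move: l1 l2; move: (inf S) (n%:R : R) => a b l1 l2.
by apply/ler_normlP; split; lra.
Qed.

Lemma homogenization_of_rate (H : R) :
  (forall e C : R, 0 < e -> 0 <= C -> exists N : nat, forall n (X : int),
     (N <= n)%N -> `|X%:~R| <= C * n%:R ->
     `|u T Tinv V delta beta th n X w - (th * X%:~R + n%:R * H)| <= e * n%:R) ->
  [/\ forall t x : R, 0 < t ->
        cvg (scaled_u T Tinv V delta beta th w t x eps @[eps --> 0^'+]),
      forall t x : R, 0 < t -> u_o T Tinv V delta beta th w t x =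
        t * effective_hamiltonian T Tinv V delta beta th w + th * x &
      effective_hamiltonian T Tinv V delta beta th w = H].
Proof.
move=> HU.
have L (t x : R) (t0 : 0 < t) :
    scaled_u T Tinv V delta beta th w t x eps @[eps --> 0^'+] --> t * H + th * x.
  exact: (scaling_limit HU).
have uE (t x : R) : 0 < t -> u_o T Tinv V delta beta th w t x = t * H + th * x.
  by move=> t0; apply: cvg_lim => //; exact: L.
have effE : effective_hamiltonian T Tinv V delta beta th w = H.
  by rewrite /effective_hamiltonian uE// mul1r mulr0 addr0.
split => // [t x t0|t x t0]; last by rewrite effE uE.
by apply/cvg_ex; exists (t * H + th * x); exact: L.
Qed.

(** The change of measure adds [n ln (cosh c)] to the logarithm for the tilted walk. The tilted
    kernel is admissible, so the lower rate applies to it, and it is the only policy allowed in the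
    upper rate: the two squeeze it. *)
Lemma srw_log_mgf_cvg (c Lam : R) : 0 < delta < 1 ->
  c = 2^-1 * ln ((1 + delta) / (1 - delta)) ->
  lower_rate delta beta (1 * (c + th)) env (Lam - ln (cosh c)) ->
  upper_rate_at [set tilt_policy c 1] beta (1 * (c + th)) env (Lam - ln (cosh c)) ->
  n%:R^-1 * srw_log_mgf T Tinv V beta th n w @[n --> \oo] --> Lam.
Proof.
move=> delta01 cE lr ur; have C0 := cosh_gt0 c.
apply/cvgrPdist_le => e e0; have [N1 H1] := lr e 0 e0 (lexx 0).
have [N2 H2] := ur e 0 e0 (lexx 0).
exists (maxn N1 N2).+1 => // n /= nN.
have n0 : (0 < n)%N by exact: leq_trans nN.
have nN1 : (N1 <= n)%N by rewrite (leq_trans _ (ltnW nN))// leq_maxl.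
have nN2 : (N2 <= n)%N by rewrite (leq_trans _ (ltnW nN))// leq_maxr.
have z0 : `|(0 : int)%:~R| <= 0 * n%:R :> R by rewrite mul0r normr0.
have [q -> {}H2] := H2 n 0 nN2 z0.
have s1 : (1 : R) = 1 \/ (1 : R) = -1 by left.
have {}H1 := H1 n 0 nN1 z0 _ (tilt_policy_ok delta01 cE s1 (n := n)).
move: H1 H2; rewrite mulr0 !add0r.
set Z := walk_exp _ _ _ _ _ => h1 h2.
have Z0 : 0 < Z := lt_le_trans (expR_gt0 _) h1.
have ZE : srw_log_mgf T Tinv V beta th n w = n%:R * ln (cosh c) + ln Z.
  rewrite /srw_log_mgf path_expectation_exp_reward.
  have fE : (fun y : int => expR (1 * c * y%:~R) * expR (th * y%:~R)) =
      (fun y => expR (1 * (c + th) * y%:~R)).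
    by apply/funext => y; rewrite -expRD; congr expR; ring.
  have := walk_exp_tilt c beta 1 env (fun y => expR (th * y%:~R)) n 0.
  by rewrite mulr0 expR0 mulr1 fE -/Z => ->; rewrite lnM ?posrE ?exprn_gt0// lnXn// mulr_natl.
have k1 : n%:R * (Lam - ln (cosh c) - e) <= ln Z.
  by rewrite -[leLHS]expRK ler_ln ?posrE ?expR_gt0.
have k2 : ln Z <= n%:R * (Lam - ln (cosh c) + e).
  by rewrite -[leRHS]expRK ler_ln ?posrE ?expR_gt0.
have np : 0 < n%:R :> R by rewrite ltr0n.
rewrite ZE mulrC; have -> : Lam - (n%:R * ln (cosh c) + ln Z) * n%:R^-1 =
  (n%:R * (Lam - ln (cosh c)) - ln Z) / n%:R by field; rewrite gt_eqF.
rewrite normrM [`|_^-1|]gtr0_norm ?invr_gt0// ler_pdivrMr//.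
move: k1 k2; move: (n%:R : R) (ln Z) => a b k1 k2.
by apply/ler_normlP; split; lra.
Qed.

End Value.

(** Two candidates hold on sets of full probability, which share a point; so the limit is unique and
    the default value is excluded. *)
Lemma tilted_free_energyE (R : realType) (d : measure_display)
    (Omega : measurableType d) (P : probability Omega R) (T Tinv : Omega -> Omega)
    (V : Omega -> R) (beta th Lam : R) :
  {ae P, forall w,
    n%:R^-1 * srw_log_mgf T Tinv V beta th n w @[n --> \oo] --> Lam} ->
  tilted_free_energy P T Tinv V beta th = Lam.
Proof.
move=> HL; rewrite /tilted_free_energy; apply: xget_unique => // l Hl.
have pf : ProperFilter (almost_everywhere P).
  have P0 : (0 < P [set: Omega])%E by have := @probability_setT _ _ _ P => ->.
  exact: (ae_properfilter_algebraOfSetsType P0).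
have [w [h1 h2]] := filter_ex (filterI HL Hl).
exact: cvg_unique h2 h1.
Qed.

Unset Implicit Arguments.

Theorem theorem2p2 (R : realType) (d : measure_display)
    (Omega : measurableType d) (P : probability Omega R)
    (T Tinv : Omega -> Omega)
    (TK : cancel T Tinv) (TinvK : cancel Tinv T)
    (mTinv : measurable_fun [set: Omega] Tinv)
    (T_mp : measure_preserving P T) (T_erg : ergodic P T)
    (V : Omega -> R) (mV : measurable_fun [set: Omega] V)
    (V01 : forall w, 0 <= V w <= 1)
    (V_nonconst : ~ exists a : R, forall w, V w = a)
    (V_ess_inf : ess_inf P (fun w => (V w)%:E) = 0%E)
    (V_ess_sup : ess_sup P (fun w => (V w)%:E) = 1%E)
    (V_low : forall (h : R) (l : nat), 0 < h < 1 -> (0 < l)%N ->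
      (0 < P [set w | forall y : nat, (y <= l)%N ->
                        (V (iterT T Tinv y w) <= h)%R])%E)
    (V_high : forall (h : R) (l : nat), 0 < h < 1 -> (0 < l)%N ->
      (0 < P [set w | forall y : nat, (y <= l)%N ->
                        (V (iterT T Tinv y w) >= h)%R])%E)
    (delta : R) (delta01 : 0 < delta < 1)
    (c : R) (cE : c = 2^-1 * ln ((1 + delta) / (1 - delta)))
    (beta : R) (beta_ge : ln (cosh c) <= beta)
    (theta : R) :
  {ae P, forall w,
    [/\ forall t x : R, 0 < t ->
          cvg (scaled_u T Tinv V delta beta theta w t x eps @[eps --> 0^'+]),
        forall t x : R, 0 < t ->
          u_o T Tinv V delta beta theta w t x
            = t * effective_hamiltonian T Tinv V delta beta theta w + theta * x &
        effective_hamiltonian T Tinv V delta beta theta w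
          = if `|theta| < c then beta - ln (cosh c)
            else tilted_free_energy P T Tinv V beta (`|theta| - c)
                 - ln (cosh c)]}.
Proof.
have [mT PT] := T_mp.
have Tinv_mp : measure_preserving P Tinv.
  split=> // A mA; rewrite -(PT (Tinv @^-1` A)); last first.
    by rewrite -[X in measurable X]setTI; exact: mTinv.
  by congr (P _); apply/seteqP; split => w /=; rewrite TK.
have Tinv_erg : ergodic P Tinv.
  move=> A mA TA; apply: T_erg => //; rewrite -{1}TA.
  by apply/seteqP; split => w /=; rewrite TK.
have c0 := drift_gt0 delta01 cE.
have beta0 : 0 <= beta := le_trans (ln_cosh_ge0 delta01 cE) beta_ge.
(* Countably many thresholds let one null set serve every real [h]; [k.+2] rather than [k.+1] keeps
   them strictly inside [(0, 1)]. *)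
have k2 (k : nat) : 0 < (k.+2%:R^-1 : R) < 1.
  by rewrite invr_gt0 ltr0n/= invf_lt1 ?ltr0n// ltr1n.
have small (h : R) : 0 < h -> exists k : nat, k.+2%:R^-1 <= h.
  move=> h0; exists (Num.truncn h^-1); rewrite -[leRHS]invrK lef_pV2 ?posrE ?invr_gt0//.
  by rewrite (le_trans (ltW (truncnS_gt _)))// ler_nat.
have high : {ae P, forall w, forall (h : R) (m : nat), 0 < h < 1 ->
    recurrent R (fun y => forall k : int, (absz (k - y)%R <= m)%N ->
      h <= V (iterT T Tinv k w))}.
  have H (k : nat) : {ae P, forall w, forall m : nat, recurrent R (fun y =>
      forall k' : int, (absz (k' - y)%R <= m)%N ->
      1 - k.+2%:R^-1 <= V (iterT T Tinv k' w))}.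
    apply: (recurrent_window TK TinvK T_mp Tinv_mp T_erg Tinv_erg mV
      (B := [set x | 1 - k.+2%:R^-1 <= x])) => [|l l0].
      rewrite (_ : [set x | _] = `[1 - k.+2%:R^-1, +oo[%classic)//.
      by apply/seteqP; split => x /=; rewrite in_itv /= andbT.
    apply: V_high l0; have /andP[k0 k1] := k2 k.
    by rewrite subr_gt0 k1 gtrBl.
  apply: filterS (ae_foralln H) => w Hw h m /andP[h0 h1] e e0.
  have [k kh] : exists k : nat, k.+2%:R^-1 <= 1 - h by apply: small; rewrite subr_gt0.
  have [K HK] := Hw k m e e0; exists K => X; have [y [Ey yX]] := HK X.
  exists y; split=> // k' /Ey; apply: le_trans.
  by rewrite lerBrDr addrC -lerBrDr.
have low : {ae P, forall w, forall (h : R) (m : nat), 0 < h < 1 ->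
    recurrent R (fun y => forall k : int, (absz (k - y)%R <= m)%N ->
      V (iterT T Tinv k w) <= h)}.
  have H (k : nat) : {ae P, forall w, forall m : nat, recurrent R (fun y =>
      forall k' : int, (absz (k' - y)%R <= m)%N ->
      V (iterT T Tinv k' w) <= k.+2%:R^-1)}.
    apply: (recurrent_window TK TinvK T_mp Tinv_mp T_erg Tinv_erg mV
      (B := [set x | x <= k.+2%:R^-1])) => [|l l0].
      rewrite (_ : [set x | _] = `]-oo, k.+2%:R^-1]%classic)//.
    exact: V_low (k2 k) l0.
  apply: filterS (ae_foralln H) => w Hw h m /andP[h0 h1] e e0.
  have [k kh] := small h h0.
  have [K HK] := Hw k m e e0; exists K => X; have [y [Ey yX]] := HK X.
  by exists y; split=> // k' /Ey h2; exact: le_trans h2 kh.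
have [thc|cth] := ltP `|theta| c.
  apply: filterS2 high low => w hi lo.
  have lr := lower_rate_bulk theta delta01 cE beta0 (fun k => V01 (iterT T Tinv k w)) hi.
  have ur := upper_rate_bulk delta01 cE beta0 (fun k => V01 (iterT T Tinv k w))
    beta_ge (ltW thc) lo.
  by apply: homogenization_of_rate; exact: (u_rate _ lr ur).
have th0 : 0 <= `|theta| - c by rewrite subr_ge0.
have [Lam HL] := rates_tilt_ae TK TinvK T_mp Tinv_mp T_erg Tinv_erg mV V01 beta0
  delta01 cE th0 high.
rewrite (@tilted_free_energyE _ _ _ _ _ _ _ _ _ Lam); last first.
  apply: filterS HL => w /(_ 1 (or_introl erefl))[lr ur].
  exact: (srw_log_mgf_cvg delta01 cE lr ur).
apply: filterS HL => w Hw; apply: homogenization_of_rate.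
(* The sign of [theta] selects the orientation. [Lam] was obtained for both orientations at once, so
   the value identified with the free energy through [s = 1] is also the one needed for negative
   [theta]. *)
pose s : R := if 0 <= theta then 1 else -1.
have s1 : s = 1 \/ s = -1 by rewrite /s; case: ifP; [left|right].
have sE : s * (c + (`|theta| - c)) = theta.
  rewrite addrC subrK /s; case: leP => h; first by rewrite mul1r ger0_norm.
  by rewrite ltr0_norm// mulN1r opprK.
have [lr ur] := Hw s s1; rewrite sE in lr ur.
apply: (u_rate _ lr ur) => q -> n; exact: tilt_policy_ok.
Qed.
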